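(* Let $\{x_k,y_k\}_{k\ge0}$ be generated by $$x_{k+1}=\mathcal{P}_{\mathcal X}\big(x_k+\alpha_k(f(x_k,y_k)-x_k+M_{k+1})\big),\qquad y_{k+1}=y_k+\beta_k\big(g(x_k,y_k)-y_k+M'_{k+1}\big),$$ where $\mathcal X$, $f,g$, the noise sequences and the step sizes satisfy all the standing assumptions (i)--(v) listed in the context, and suppose that $\beta/\alpha\le\gamma_1$ and $K_1\ge\gamma_2$. Then: (1) There exist constants $C_1',C_2'>0$ such that for all $k\ge0$, $$\mathbb{E}\big[\|x_k-\hat x(y_k)\|^2\big]\le\frac{C_1'}{(k+1)^{\mathfrak a}}\quad\text{and}\quad\mathbb{E}\big[\|g(\hat x(y_k),y_k)-y_k\|^2\big]\le\frac{C_2'}{(k+1)^{1-\mathfrak b}}.$$ (2) With probability $1$, $\|x_k-\hat x(y_k)\|\to0$ and the iterates $y_k$ converge to the set $\hat{\mathcal Y}$ (i.e. the distance from $y_k$ to $\hat{\mathcal Y}$ tends to $0$).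
   Context: $\|\cdot\|$ is the Euclidean norm. $\mathcal X\subset\mathbb{R}^{d_1}$ is a non-empty, closed, convex and bounded set and $\mathcal{P}_{\mathcal X}(x)=\arg\min_{x'\in\mathcal X}\|x-x'\|$ is the projection onto it. Let $f:\mathbb{R}^{d_1}\times\mathbb{R}^{d_2}\to\mathbb{R}^{d_1}$ and $g:\mathbb{R}^{d_1}\times\mathbb{R}^{d_2}\to\mathbb{R}^{d_2}$. The initial points $x_0\in\mathbb{R}^{d_1}$, $y_0\in\mathbb{R}^{d_2}$ are deterministic. Standing assumptions: (i) (Contraction.) There is a constant $0\le\mu<1$ with $\|f(x_1,y)-f(x_2,y)\|\le\mu\|x_1-x_2\|$ for all $x_1,x_2\in\mathbb{R}^{d_1}$, $y\in\mathbb{R}^{d_2}$. For each $y$, $\hat x(y)$ denotes the unique point satisfying $\hat x(y)=\mathcal{P}_{\mathcal X}(f(\hat x(y),y))$. (ii) (Non-expansiveness.) $\|g(\hat x(y_1),y_1)-g(\hat x(y_2),y_2)\|\le\|y_1-y_2\|$ for all $y_1,y_2\in\mathbb{R}^{d_2}$, and the set $\hat{\mathcal Y}=\{y\in\mathbb{R}^{d_2}: g(\hat x(y),y)=y\}$ is non-empty. (iii) (Lipschitz.) There are constants $L,\mathfrak{c}_1>0$ such that $\|f(x_1,y_1)-f(x_2,y_2)\|+\|g(x_1,y_1)-g(x_2,y_2)\|\le L(\|x_1-x_2\|+\|y_1-y_2\|)$ and $\|f(x,y)\|+\|g(x,y)\|\le\mathfrak{c}_1(1+\|x\|+\|y\|)$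 for all arguments. (iv) (Noise.) With $\mathcal{F}_k=\sigma(x_0,y_0,M_i,M'_i,\ i\le k)$, the $\mathbb{R}^{d_1}$- and $\mathbb{R}^{d_2}$-valued sequences $\{M_{k+1}\}$, $\{M'_{k+1}\}$ satisfy $\mathbb{E}[M_{k+1}\mid\mathcal{F}_k]=0$, $\mathbb{E}[M'_{k+1}\mid\mathcal{F}_k]=0$ and, for some constant $\mathfrak{c}_2>0$, $\mathbb{E}[\|M_{k+1}\|^2+\|M'_{k+1}\|^2\mid\mathcal{F}_k]\le\mathfrak{c}_2(1+\|x_k\|^2+\|y_k\|^2)$ for all $k\ge0$. (v) (Step sizes.) $\alpha_k=\alpha/(k+K_1)^{\mathfrak a}$ and $\beta_k=\beta/(k+K_1)^{\mathfrak b}$ with $0.5<\mathfrak a<\mathfrak b<1$, $0<\alpha,\beta\le0.5$, $K_1\ge1$, and $\beta_k^2/\alpha_k^3\le1$ for all $k\ge0$. Define $\gamma_1=(1-\mu)/(2L^2)$ and $\gamma_2=\max\big\{\big(2\mathfrak a/((1-\mu)\alpha)\big)^{1/(1-\mathfrak a)},\ \big(2\mathfrak b/\beta\big)^{1/(1-\mathfrak b)}\big\}$. *)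

(* Defs.v *)
From HB Require Import structures.
From mathcomp Require Import all_boot all_order all_algebra.
From mathcomp Require Import all_classical all_reals all_analysis.
From mathcomp Require Import measurable_realfun.

Set Implicit Arguments.
Unset Strict Implicit.
Unset Printing Implicit Defensive.

Import Order.TTheory GRing.Theory Num.Theory.
Import numFieldNormedType.Exports.

Local Open Scope classical_set_scope.
Local Open Scope ring_scope.

(* The library's norm `|x| on 'rV[R]_n is the sup norm, hence this one.
   The topology on 'rV[R]_n, used for [closed], is the usual one of R^n. *)
Definition eucl_norm (R : realType) (n : nat) (x : 'rV[R]_n) : R :=
  Num.sqrt (\sum_(j < n) x ord0 j ^+ 2).

Definition eucl_dist (R : realType) (n : nat) (x : 'rV[R]_n)
    (A : set 'rV[R]_n) : R :=
  inf [set eucl_norm (x - z) | z in A].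

(* Junk value 0 when the nearest point does not exist; it exists and is unique
   as soon as X is nonempty, closed and convex. *)
Definition eucl_proj (R : realType) (n : nat) (X : set 'rV[R]_n) (x : 'rV[R]_n) :
    'rV[R]_n :=
  xget 0 [set p | X p /\
    forall x', X x' -> eucl_norm (x - p) <= eucl_norm (x - x')].

(* Junk value 0 when there is no fixed point; there is exactly one when X is
   nonempty, closed and convex and f is a contraction in its first argument. *)
Definition xhat (R : realType) (d1 d2 : nat) (X : set 'rV[R]_d1)
    (f : 'rV[R]_d1 -> 'rV[R]_d2 -> 'rV[R]_d1) (y : 'rV[R]_d2) : 'rV[R]_d1 :=
  xget 0 [set x | x = eucl_proj X (f x y)].

Definition Yhat (R : realType) (d1 d2 : nat) (X : set 'rV[R]_d1)
    (f : 'rV[R]_d1 -> 'rV[R]_d2 -> 'rV[R]_d1)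
    (g : 'rV[R]_d1 -> 'rV[R]_d2 -> 'rV[R]_d2) : set 'rV[R]_d2 :=
  [set y | g (xhat X f y) y = y].

Definition step_size (R : realType) (c e K : R) (k : nat) : R :=
  c / (k%:R + K) `^ e.

Definition gamma1 (R : realType) (mu L : R) : R := (1 - mu) / (2 * L ^+ 2).

Definition gamma2 (R : realType) (mu alpha beta a b : R) : R :=
  Num.max ((2 * a / ((1 - mu) * alpha)) `^ (1 - a)^-1)
          ((2 * b / beta) `^ (1 - b)^-1).

Definition random_vector (R : realType) (d : measure_display)
    (T : measurableType d) (n : nat) (V : T -> 'rV[R]_n) : Prop :=
  forall j : 'I_n, measurable_fun [set: T] (fun w => V w ord0 j).

(* A generating family of the sigma-algebra of V: preimages of Borel sets by
   the coordinates. *)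
Definition vector_events (R : realType) (T : Type) (n : nat)
    (V : T -> 'rV[R]_n) : set_system T :=
  \bigcup_j preimage_set_system [set: T] (fun w => V w ord0 j)
              (measurable : set (set R)).

(* F_k = sigma(x0, y0, M_i, M'_i, i <= k). The noise starts at index 1: the
   values M 0 and M' 0 play no role. *)
Definition noise_filtration (R : realType) (T : Type) (d1 d2 : nat)
    (x0 : 'rV[R]_d1) (y0 : 'rV[R]_d2)
    (M : nat -> T -> 'rV[R]_d1) (M' : nat -> T -> 'rV[R]_d2) (k : nat) :
    set_system T :=
  <<s vector_events (fun=> x0) `|` vector_events (fun=> y0) `|`
      \bigcup_(i in [set i | (0 < i <= k)%N])
        (vector_events (M i) `|` vector_events (M' i)) >>.

Definition has_expectation (R : realType) (d : measure_display)
    (T : measurableType d) (P : probability T R) (X : T -> \bar R) : Prop :=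
  P.-integrable [set: T] X \/
  (measurable_fun [set: T] X /\ forall w, (0 <= X w)%E).

(* Z is a version of E[X | G], for X integrable or nonnegative. *)
Definition is_cond_expectation (R : realType) (d : measure_display)
    (T : measurableType d) (P : probability T R) (G : set_system T)
    (X Z : T -> \bar R) : Prop :=
  [/\ has_expectation P X,
      has_expectation P Z,
      (forall B : set (\bar R), measurable B -> G (Z @^-1` B)) &
      forall A, G A -> (\int[P]_(w in A) Z w = \int[P]_(w in A) X w)%E].

(* Main.v *)
(* Write E_k = E|x_k - xhat(y_k)|^2, h(y) = g(xhat(y), y), and D_k, H_k for the
   expected squares of y_k - y* and h(y_k) - y_k.  One step gives
     E_{k+1} <= (1 - (1-mu) alpha_k) E_k + C alpha_k^2 (1 + D_k),
     D_{k+1} <= (1 + alpha_k^2) D_k - beta_k/2 H_k + 2 L^2 alpha_k E_k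
                + C alpha_k^2 (1 + D_k),
   where beta_k^2 <= alpha_k^3 makes every error of order alpha_k^2, which is
   summable.  So D + (2 L^2/(1-mu)) E is bounded, hence E_k = O(alpha_k) and
   sum beta_k H_k is finite.  For the last iterate, subtract from y_k the average
   U_{k+1} = (1-beta_k) U_k + beta_k M'_{k+1}, with E|U_k|^2 = O(beta_k):
   z = y - U is an inexact Krasnoselskii-Mann iteration whose residual is almost
   nonincreasing (cocoercivity of id - h), up to O(alpha_k beta_k) in mean
   square, so the residual decays like 1/sum_{j<k} beta_j = O(k^(b-1)).
   Almost surely: |x_k - xhat(y_k)|^2 and dist(y_k, Yhat)^2 are nonnegative almost
   supermartingales that tend to 0 in probability (for the distance, by
   compactness, from tightness of y_k and H_k -> 0); the maximal inequality then
   upgrades this to almost sure convergence. *)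
Require Import Defs.
From HB Require Import structures.
From mathcomp Require Import all_boot all_order all_algebra.
From mathcomp Require Import all_classical all_reals all_analysis.
From mathcomp Require Import measurable_realfun.
From mathcomp Require Import ring lra.

Import Order.TTheory GRing.Theory Num.Theory.
Import numFieldNormedType.Exports.

Local Open Scope classical_set_scope.
Local Open Scope ring_scope.

(** * Euclidean geometry and projections *)

(** The obstacle is the rate for the last iterate. Applied to [y k] itself, [residual_step] would
    charge the fresh noise [2 * t k * |M' k.+1|^2]: [h] is only Lipschitz, so no first-order term
    averages out, and the steps are not summable. For [z = y - U] the noise cancels exactly, and
    besides the tracking error only [h (y k) - h (z k)] remains, of norm at most [|U k|]. The weight
    put on the residual is [(k + K1) * t k], an explicit stand-in for the sum of the steps.
    Conditional expectations are never formed: each one-step inequality is integrated over an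
    arbitrary event of F_k. The whole space yields the rates, general events the supermartingale
    property. Likewise, sums of squared steps enter only through an explicit sequence [T] with
    [st k ^+ 2 + T k.+1 <= T k]. The lower bound on [K1] makes the steps decrease slowly,
    [st k - st k.+1 <= rho / 2 * st k ^+ 2], so that bounds of order [st k] propagate through the
    recursions. *)

Definition dot {R : realType} {n : nat} (u v : 'rV[R]_n) : R :=
  \sum_(j < n) u ord0 j * v ord0 j.

Section euclidean_norm.
Context {R : realType} {n : nat}.
Implicit Types (u v w : 'rV[R]_n) (k : R).

Lemma dotC u v : dot u v = dot v u.
Proof. by apply: eq_bigr => j _; rewrite mulrC. Qed.

Lemma dotDl u v w : dot (u + v) w = dot u w + dot v w.
Proof. by rewrite -big_split; apply: eq_bigr => j _; rewrite mxE mulrDl. Qed.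

Lemma dotZl k u v : dot (k *: u) v = k * dot u v.
Proof. by rewrite mulr_sumr; apply: eq_bigr => j _; rewrite mxE mulrA. Qed.

Lemma dotDr u v w : dot u (v + w) = dot u v + dot u w.
Proof. by rewrite dotC dotDl (dotC v) (dotC w). Qed.

Lemma dotZr k u v : dot u (k *: v) = k * dot u v.
Proof. by rewrite dotC dotZl dotC. Qed.

Lemma dotNl u v : dot (- u) v = - dot u v.
Proof. by rewrite -scaleN1r dotZl mulN1r. Qed.

Lemma dotNr u v : dot u (- v) = - dot u v.
Proof. by rewrite dotC dotNl dotC. Qed.

Definition dotE := (dotDl, dotDr, dotNl, dotNr, dotZl, dotZr).

Lemma dot_ge0 u : 0 <= dot u u.
Proof. by apply: sumr_ge0 => j _; rewrite -expr2 sqr_ge0. Qed.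

Lemma eucl_norm_sqr u : eucl_norm u ^+ 2 = dot u u.
Proof.
have dE : \sum_(j < n) u ord0 j ^+ 2 = dot u u.
  by apply: eq_bigr => j _; rewrite expr2.
by rewrite /eucl_norm dE sqr_sqrtr// dot_ge0.
Qed.

Lemma eucl_norm_ge0 u : 0 <= eucl_norm u.
Proof. exact: sqrtr_ge0. Qed.
Hint Resolve eucl_norm_ge0 : core.

Lemma eucl_norm0 : eucl_norm (0 : 'rV[R]_n) = 0.
Proof.
apply/eqP; rewrite -sqrf_eq0 eucl_norm_sqr; apply/eqP.
by apply: big1 => j _; rewrite mxE mul0r.
Qed.

Lemma eucl_norm_eq0 u : eucl_norm u = 0 -> u = 0.
Proof.
move=> u0; have : dot u u = 0 by rewrite -eucl_norm_sqr u0 expr0n.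
move/psumr_eq0P => u0j; apply/rowP => j; rewrite mxE.
have /eqP := u0j (fun i _ => sqr_ge0 (u ord0 i)) j isT.
by rewrite mulf_eq0 orbb => /eqP.
Qed.

Lemma eucl_normZ k u : eucl_norm (k *: u) = `|k| * eucl_norm u.
Proof.
apply: (pexpIrn (n := 2)) => //; rewrite ?nnegrE ?mulr_ge0 ?normr_ge0//.
by rewrite exprMn real_normK ?num_real// !eucl_norm_sqr !dotE; ring.
Qed.

Lemma eucl_normN u : eucl_norm (- u) = eucl_norm u.
Proof. by rewrite -scaleN1r eucl_normZ normrN1 mul1r. Qed.

Lemma eucl_normB u v : eucl_norm (u - v) = eucl_norm (v - u).
Proof. by rewrite -eucl_normN opprB. Qed.

Lemma cauchy_schwarz u v : dot u v <= eucl_norm u * eucl_norm v.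
Proof.
have [v0|v0] := eqVneq (dot v v) 0.
  have -> : v = 0 by apply: eucl_norm_eq0; apply/eqP; rewrite -sqrf_eq0 eucl_norm_sqr v0.
  rewrite eucl_norm0 mulr0 dotC /dot big1// => j _.
  by rewrite mxE mul0r.
have vp : 0 < dot v v by rewrite lt_neqAle eq_sym v0 dot_ge0.
have h := dot_ge0 (dot v v *: u - dot u v *: v).
have hE : dot (dot v v *: u - dot u v *: v) (dot v v *: u - dot u v *: v) =
    dot v v * (dot u u * dot v v - dot u v ^+ 2).
  by rewrite !dotE (dotC v u); ring.
rewrite hE pmulr_rge0// -!eucl_norm_sqr -exprMn subr_ge0 in h.
have [uv|/ltW uv] := leP 0 (dot u v).
  by rewrite -(@ler_pXn2r _ 2)// ?nnegrE ?mulr_ge0.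
by rewrite (le_trans uv)// mulr_ge0.
Qed.

Lemma sqr_eucl_normZ k u : eucl_norm (k *: u) ^+ 2 = k ^+ 2 * eucl_norm u ^+ 2.
Proof. by rewrite eucl_normZ exprMn real_normK ?num_real. Qed.

Lemma sqr_eucl_normD u v : eucl_norm (u + v) ^+ 2 =
  eucl_norm u ^+ 2 + 2 * dot u v + eucl_norm v ^+ 2.
Proof. by rewrite !eucl_norm_sqr !dotE (dotC v u); ring. Qed.

Lemma ler_eucl_normD u v : eucl_norm (u + v) <= eucl_norm u + eucl_norm v.
Proof.
rewrite -(@ler_pXn2r _ 2)// ?nnegrE ?addr_ge0//.
rewrite eucl_norm_sqr sqrrD !eucl_norm_sqr !dotE (dotC v u).
by have := cauchy_schwarz u v; lra.
Qed.

Lemma ler_eucl_dist_dist u v : `|eucl_norm u - eucl_norm v| <= eucl_norm (u - v).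
Proof.
rewrite ler_norml; have := ler_eucl_normD (u - v) v; rewrite subrK.
have := ler_eucl_normD (v - u) u; rewrite subrK eucl_normB; lra.
Qed.

Lemma ler_eucl_normB u v w :
  eucl_norm (u - v) <= eucl_norm (u - w) + eucl_norm (w - v).
Proof. by rewrite (le_trans _ (ler_eucl_normD _ _))// addrA subrK. Qed.

(** Young's inequality, from the square of [s *: u - v]. The weight stays free: the fast step takes
    [(1 - mu) * s k], the slow one [s k ^+ 2]. *)
Lemma sqr_eucl_normD_le (s : R) u v : 0 < s ->
  eucl_norm (u + v) ^+ 2 <=
    (1 + s) * eucl_norm u ^+ 2 + (1 + s^-1) * eucl_norm v ^+ 2.
Proof.
move=> s0; have h := dot_ge0 (s *: u - v).
have : 0 <= s^-1 * dot (s *: u - v) (s *: u - v).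
  by rewrite mulr_ge0// invr_ge0 ltW.
rewrite !eucl_norm_sqr !dotE (dotC v u).
rewrite (_ : s^-1 * _ = s * dot u u - 2 * dot u v + s^-1 * dot v v); first by lra.
by field; rewrite gt_eqF.
Qed.

Lemma sqr_eucl_normD_le2 u v :
  eucl_norm (u + v) ^+ 2 <= 2 * eucl_norm u ^+ 2 + 2 * eucl_norm v ^+ 2.
Proof. by have := @sqr_eucl_normD_le 1 u v ltr01; rewrite invr1; lra. Qed.

Lemma ler_coord_eucl_norm u (j : 'I_n) : `|u ord0 j| <= eucl_norm u.
Proof.
rewrite -(@ler_pXn2r _ 2)// ?nnegrE// real_normK ?num_real// eucl_norm_sqr.
rewrite /dot (bigD1 j)//= expr2 lerDl; apply: sumr_ge0 => i _.
by rewrite -expr2 sqr_ge0.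
Qed.

Lemma ler_coord_sup_norm u (j : 'I_n) : `|u ord0 j| <= `|u|.
Proof.
by rewrite [in leRHS]/Num.norm/= mx_normrE; apply: (le_bigmax _ _ (ord0, j)).
Qed.

Lemma eucl_norm_le_sup_norm u : eucl_norm u <= n%:R * `|u|.
Proof.
rewrite -(@ler_pXn2r _ 2)// ?nnegrE ?mulr_ge0 ?normr_ge0//.
rewrite eucl_norm_sqr /dot (@le_trans _ _ (n%:R * `|u| ^+ 2))//.
  rewrite -[X in X%:R]card_ord -sum1_card natr_sum mulr_suml.
  apply: ler_sum => j _; rewrite mul1r -expr2 -real_normK ?num_real//.
  by rewrite ler_pXn2r// ?nnegrE ?normr_ge0// ler_coord_sup_norm.
rewrite exprMn ler_wpM2r ?sqr_ge0//.
by rewrite -natrX ler_nat; case: (n) => // m; rewrite leq_pmull.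
Qed.

Lemma sup_norm_le_eucl_norm u : `|u| <= eucl_norm u.
Proof.
rewrite [in leLHS]/Num.norm/= mx_normrE; apply: bigmax_le => // -[i j] _ /=.
by rewrite ord1 ler_coord_eucl_norm.
Qed.

(** The topology is that of the sup norm, and comparing it with the Euclidean norm costs a factor
    [n]. The [+ 1] in [K] keeps it positive in degenerate cases. *)
Lemma eucl_lipschitz_continuous (C : R) (phi : 'rV[R]_n -> R) :
  (forall u v, `|phi u - phi v| <= C * eucl_norm (u - v)) -> continuous phi.
Proof.
move=> lip u; have fu : Filter (nbhs u) by exact: nbhs_filter.
apply/(@cvgrPdist_lt _ _ _ (nbhs u) fu phi (phi u)) => e e0.
pose K := `|C| * n%:R + 1.
have K0 : 0 < K by rewrite ltr_wpDl ?mulr_ge0 ?normr_ge0.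
apply/nbhs_ballP; exists (e / K) => [|v]; first exact: divr_gt0.
rewrite -ball_normE /= => uv.
rewrite (le_lt_trans (lip u v))// (@le_lt_trans _ _ (`|C| * (n%:R * `|u - v|)))//.
  rewrite (le_trans (ler_wpM2r (eucl_norm_ge0 _) (ler_norm C)))//.
  by rewrite ler_wpM2l ?eucl_norm_le_sup_norm.
rewrite (@le_lt_trans _ _ (K * `|u - v|))//.
  by rewrite mulrA ler_wpM2r// lerDl.
by rewrite -ltr_pdivlMl// mulrC.
Qed.

Lemma eucl_bounded_set (A : set 'rV[R]_n) (B : R) :
  (forall u, A u -> eucl_norm u <= B) -> bounded_set A.
Proof.
move=> AB; exists B; split; first exact: num_real.
move=> r Br u Au.
by apply: (le_trans (sup_norm_le_eucl_norm u)); apply: (le_trans (AB _ Au)); apply: ltW.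
Qed.

Lemma eucl_lipschitz_closed_le (C r : R) (phi : 'rV[R]_n -> R) :
  (forall u v, `|phi u - phi v| <= C * eucl_norm (u - v)) ->
  closed [set u | phi u <= r].
Proof.
move=> /eucl_lipschitz_continuous cphi.
by apply: (@closed_comp _ _ phi [set t | t <= r]) => [u _|]; [exact: cphi|exact: closed_le].
Qed.

Lemma eucl_norm_lipschitz w u v :
  `|eucl_norm (w - u) - eucl_norm (w - v)| <= 1 * eucl_norm (u - v).
Proof.
rewrite mul1r (le_trans (ler_eucl_dist_dist _ _))//.
rewrite (eucl_normB u) (_ : w - u - (w - v) = v - u)//.
by apply/rowP => j; rewrite !mxE; ring.
Qed.

End euclidean_norm.
#[global] Hint Extern 0 (is_true (0 <= eucl_norm _)) => exact: eucl_norm_ge0 : core.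

Section projection.
Context {R : realType} {n : nat} {X : set 'rV[R]_n}.
Hypotheses (X_nonempty : X !=set0) (X_closed : closed X)
  (X_convex : @convex_set R 'rV[R]_n X).
Implicit Types (u v z : 'rV[R]_n).

(** The set may be unbounded (it is later the fixed-point set of [h]), so the minimum is taken over
    the compact part no farther from [u] than a chosen point [z0]. *)
Lemma eucl_projP u : X (eucl_proj X u) /\
  forall z, X z -> eucl_norm (u - eucl_proj X u) <= eucl_norm (u - z).
Proof.
case: X_nonempty => z0 Xz0.
have [p []] : exists p, X p /\ forall z, X z -> eucl_norm (u - p) <= eucl_norm (u - z).
  pose A := X `&` [set z | eucl_norm (u - z) <= eucl_norm (u - z0)].
  have cA : compact A.
    apply: bounded_closed_compact.
      apply: (@eucl_bounded_set _ _ _ (eucl_norm u + eucl_norm (u - z0))) => z [_ /= uz].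
      have := ler_eucl_normD u (z - u); rewrite addrC subrK eucl_normB; lra.
    apply: closedI => //.
    exact: (@eucl_lipschitz_closed_le _ _ 1 _ _ (eucl_norm_lipschitz u)).
  have A0 : A !=set0 by exists z0; split => //=.
  have cN : {within A, continuous (fun z => eucl_norm (u - z))}.
    apply: continuous_subspaceT.
    exact: eucl_lipschitz_continuous (eucl_norm_lipschitz u).
  have [p] := compact_EVT_min A0 cA cN.
  rewrite inE => -[Xp up] pmin; exists p; split=> // z Xz.
  have [uz|/ltW uz] := leP (eucl_norm (u - z)) (eucl_norm (u - z0)).
    by apply: pmin; rewrite inE.
  exact: le_trans up uz.
move=> Xp pmin; rewrite /eucl_proj; case: xgetP => [q -> []//|/(_ p)].
by case.
Qed.

Lemma convex_setE (t : R) z1 z2 : 0 <= t <= 1 -> X z1 -> X z2 ->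
  X (t *: z1 + (1 - t) *: z2).
Proof.
move=> /andP[t0 t1] /mem_set X1 /mem_set X2.
have := @X_convex z1 z2 (Itv01 t0 t1) X1 X2.
by rewrite inE.
Qed.

(* Variational inequality: perturb p towards z by a small t and let t -> 0. *)
Lemma eucl_proj_dot_le0 u z : X z ->
  dot (u - eucl_proj X u) (z - eucl_proj X u) <= 0.
Proof.
move=> Xz; have [Xp pmin] := eucl_projP u; set p := eucl_proj X u in Xp pmin *.
rewrite leNgt; apply/negP => d0.
set D := dot (u - p) (z - p) in d0; pose N := dot (z - p) (z - p).
have N0 : 0 <= N by exact: dot_ge0.
(* Minimality fails for any [t] in ]0, 1] with [t * N < 2 * D]; this choice has a positive
   denominator whatever [N >= 0] is. *)
pose t := D / (D + N).
have DN0 : 0 < D + N by rewrite ltr_wpDr.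
have t0 : 0 < t by rewrite divr_gt0.
have t1 : t <= 1 by rewrite ler_pdivrMr// mul1r lerDl.
have Xq : X (t *: z + (1 - t) *: p) by apply: convex_setE => //; rewrite ltW.
have := pmin _ Xq; rewrite -(@ler_pXn2r _ 2 isT) ?nnegrE// !eucl_norm_sqr.
have -> : u - (t *: z + (1 - t) *: p) = (u - p) - t *: (z - p).
  by rewrite scalerBl scale1r scalerBr opprD !opprB !addrA; apply/rowP => j; rewrite !mxE; ring.
have E (v w : 'rV[R]_n) :
    dot (v - t *: w) (v - t *: w) = dot v v - 2 * t * dot v w + t * (t * dot w w).
  by rewrite !dotE (dotC w v); ring.
rewrite E -/D -/N => h.
have h2 : 2 * t * D <= t * (t * N) by lra.
have : t * N < 2 * D.
  rewrite /t mulrAC ltr_pdivrMr//.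
  have : D * N < 2 * (D * (D + N)); last by lra.
  have : 0 <= D * N by rewrite mulr_ge0// ltW.
  have : 0 < D * D by rewrite mulr_gt0.
  lra.
rewrite -(ltr_pM2l t0); lra.
Qed.

(** Adding the variational inequalities at [p] and at the projection [q] leaves [|q - p|^2 <= 0]. *)
Lemma eucl_proj_eq u p : X p -> (forall z, X z -> dot (u - p) (z - p) <= 0) ->
  eucl_proj X u = p.
Proof.
move=> Xp vi; have [Xq _] := eucl_projP u; have viq := eucl_proj_dot_le0 u _ Xp.
set q := eucl_proj X u in Xq viq *; have {vi} := vi _ Xq.
have -> : u - p = (u - q) + (q - p) by rewrite addrA subrK.
rewrite dotDl.
move: viq; rewrite -(opprB q p) dotNr => h1 h2.
apply/eqP; rewrite -subr_eq0; apply/eqP; apply: eucl_norm_eq0.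
apply/eqP; rewrite -sqrf_eq0 eucl_norm_sqr eq_le dot_ge0 andbT.
lra.
Qed.

(** The two variational inequalities add up to [|p - q|^2 <= dot (u - v) (p - q)]; Cauchy-Schwarz
    concludes. *)
Lemma eucl_proj_nonexpansive u v :
  eucl_norm (eucl_proj X u - eucl_proj X v) <= eucl_norm (u - v).
Proof.
have [Xp _] := eucl_projP u; have [Xq _] := eucl_projP v.
have h1 := eucl_proj_dot_le0 u _ Xq; have h2 := eucl_proj_dot_le0 v _ Xp.
move: (eucl_proj X u) (eucl_proj X v) {Xp Xq} h1 h2 => p q h1 h2.
have h3 : dot (p - q) (p - q) <= dot (u - v) (p - q).
  have -> : dot (u - v) (p - q) =
      dot (u - p) (p - q) - dot (v - q) (p - q) + dot (p - q) (p - q).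
    by rewrite !dotE; ring.
  by move: h1; rewrite -(opprB p q) dotNr; lra.
have h4 := cauchy_schwarz (u - v) (p - q).
have := le_trans h3 h4; rewrite -eucl_norm_sqr expr2.
have [->//|N0] := eqVneq (eucl_norm (p - q)) 0.
by rewrite ler_pM2r// lt_neqAle eq_sym N0 eucl_norm_ge0.
Qed.

Lemma eucl_proj_id u : X u -> eucl_proj X u = u.
Proof.
move=> Xu; apply: eucl_proj_eq => // z _.
by rewrite subrr -(scale0r (0 : 'rV[R]_n)) dotZl mul0r.
Qed.

Lemma eucl_dist_proj u : eucl_dist u X = eucl_norm (u - eucl_proj X u).
Proof.
have [Xp pmin] := eucl_projP u; apply/eqP; rewrite eq_le; apply/andP; split.
  apply: ge_inf; last by exists (eucl_proj X u).
  by exists 0 => _ [z _ <-].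
apply: lb_le_inf; first by exists (eucl_norm (u - eucl_proj X u)), (eucl_proj X u).
by move=> _ [z Xz <-]; exact: pmin.
Qed.

Lemma eucl_dist_lipschitz u v :
  `|eucl_dist u X - eucl_dist v X| <= 1 * eucl_norm (u - v).
Proof.
have one_side a b : eucl_dist a X <= eucl_dist b X + eucl_norm (a - b).
  have [_ amin] := eucl_projP a; have [Xq _] := eucl_projP b.
  rewrite !eucl_dist_proj (le_trans (amin _ Xq))// [leRHS]addrC.
  exact: ler_eucl_normB.
rewrite mul1r ler_norml lerBlDl one_side andbT lerBrDr addrC lerBlDr.
by rewrite (eucl_normB u) one_side.
Qed.

(** The outward normals at [p] form a cone, so scaling [z - p] keeps the projection. This exhibits
    [xhat] as the projection of its own relaxed step, comparable with [x k.+1] by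
    nonexpansiveness. *)
Lemma eucl_proj_fixed_relax (t : R) p z : 0 <= t -> p = eucl_proj X z ->
  eucl_proj X (p + t *: (z - p)) = p.
Proof.
move=> t0 pz; have [Xp _] := eucl_projP z; rewrite -pz in Xp.
apply: eucl_proj_eq => // w Xw; rewrite addrAC subrr add0r dotZl.
by rewrite mulr_ge0_le0// pz eucl_proj_dot_le0.
Qed.

End projection.

Lemma ler_sqr_sum3 {R : realType} (r s t : R) :
  (r + s + t) ^+ 2 <= 3 * (r ^+ 2 + s ^+ 2 + t ^+ 2).
Proof.
have := sqr_ge0 (r - s); have := sqr_ge0 (r - t); have := sqr_ge0 (s - t).
by rewrite !expr2; lra.
Qed.

(** * Nonexpansive maps, their fixed points and residuals *)

Section nonexpansive.
Context {R : realType} {n : nat} (h : 'rV[R]_n -> 'rV[R]_n).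
Hypothesis h_nonexpansive : forall u v,
  eucl_norm (h u - h v) <= eucl_norm (u - v).
Implicit Types (u v z p : 'rV[R]_n).

Lemma residual_lipschitz u v :
  eucl_norm ((h u - u) - (h v - v)) <= 2 * eucl_norm (u - v).
Proof.
rewrite (_ : _ - _ = (h u - h v) - (u - v)); last first.
  by apply/rowP => j; rewrite !mxE; ring.
rewrite (le_trans (ler_eucl_normD _ _))// eucl_normN.
by rewrite (_ : 2 * _ = eucl_norm (u - v) + eucl_norm (u - v)) ?lerD2r//; ring.
Qed.

Lemma residual_norm_lipschitz u v :
  `|eucl_norm (h u - u) - eucl_norm (h v - v)| <= 2 * eucl_norm (u - v).
Proof. exact: le_trans (ler_eucl_dist_dist _ _) (residual_lipschitz u v). Qed.

Lemma closed_fixpoints : closed [set u | h u = u].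
Proof.
rewrite (_ : mkset _ = [set u | eucl_norm (h u - u) <= 0]).
  exact: eucl_lipschitz_closed_le residual_norm_lipschitz.
apply/seteqP; split => u /=; first by move=> ->; rewrite subrr eucl_norm0.
move=> u0; apply/eqP; rewrite -subr_eq0; apply/eqP/eucl_norm_eq0/eqP.
by rewrite eq_le u0 eucl_norm_ge0.
Qed.

(** With [A = h q - p1] and [B = h q - p2], one has [|h q - q|^2 = t |A|^2 + (1 - t) |B|^2 - t (1 -
    t) |A - B|^2]. Nonexpansiveness bounds [|A|] by [(1 - t) |p1 - p2|] and [|B|] by [t |p1 - p2|],
    so the right-hand side is at most 0. *)
Lemma convex_fixpoints : @convex_set R 'rV[R]_n [set u | h u = u].
Proof.
move=> p1 p2 l; rewrite !inE /= => h1 h2.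
set q := conv l p1 p2.
have {q} -> : q = l%:num *: p1 + (1 - l%:num) *: p2 by [].
have t0 : 0 <= l%:num by []; have t1 : l%:num <= 1 by [].
move: (l%:num) t0 t1 => t t0 t1; set q := _ + _.
have qE1 : q - p1 = (1 - t) *: (p2 - p1).
  by rewrite /q; apply/rowP => j; rewrite !mxE; ring.
have qE2 : q - p2 = t *: (p1 - p2).
  by rewrite /q; apply/rowP => j; rewrite !mxE; ring.
have D1 := h_nonexpansive q p1; have D2 := h_nonexpansive q p2.
rewrite h1 qE1 -(@ler_pXn2r _ 2 isT) ?nnegrE// !eucl_norm_sqr in D1.
rewrite h2 qE2 -(@ler_pXn2r _ 2 isT) ?nnegrE// !eucl_norm_sqr in D2.
have DD : dot (p1 - p2) (p1 - p2) = dot (p2 - p1) (p2 - p1).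
  by rewrite -!eucl_norm_sqr eucl_normB.
have qE : h q - q = t *: (h q - p1) + (1 - t) *: (h q - p2).
  by rewrite /q; apply/rowP => j; rewrite !mxE; ring.
have DE : p1 - p2 = (h q - p2) - (h q - p1).
  by apply/rowP => j; rewrite !mxE; ring.
apply/eqP; rewrite -subr_eq0; apply/eqP/eucl_norm_eq0/eqP.
rewrite -sqrf_eq0 eucl_norm_sqr eq_le dot_ge0 andbT qE.
rewrite !dotZl !dotZr DD -DD in D1 D2; rewrite DE in D1 D2.
move: (h q - p1) (h q - p2) D1 D2 => A B D1 D2.
have {}D1 := ler_wpM2l t0 D1.
have {}D2 : (1 - t) * dot B B <= (1 - t) * (t * (t * dot (B - A) (B - A))).
  by rewrite ler_wpM2l ?subr_ge0.
move: D1 D2; rewrite !dotE !(dotC B A).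
move: (dot A A) (dot B B) (dot A B) => AA BB AB; lra.
Qed.

(* u - h u is cocoercive, so the residual can only grow through the error e. *)
Lemma residual_step (t : R) z v : 0 < t <= 2^-1 ->
  eucl_norm (h (z + t *: (v - z)) - (z + t *: (v - z))) ^+ 2 <=
  eucl_norm (h z - z) ^+ 2 + 2 * t * eucl_norm (v - h z) ^+ 2.
Proof.
move=> /andP[t0 t1]; set z1 := z + _.
have hz := h_nonexpansive z1 z.
rewrite -(@ler_pXn2r _ 2 isT) ?nnegrE// !eucl_norm_sqr in hz.
rewrite !eucl_norm_sqr.
have e1 : z1 - z = t *: (v - h z + (h z - z)).
  by rewrite /z1; apply/rowP => j; rewrite !mxE; ring.
have e2 : h z1 - h z = (h z1 - z1) - (h z - z) + (z1 - z).
  by apply/rowP => j; rewrite !mxE; ring.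
rewrite e2 e1 in hz.
move: (h z1 - z1) (h z - z) (v - h z) hz => G1 G0 e.
have [d ->] : exists d, G1 = G0 + d by exists (G1 - G0); rewrite addrC subrK.
rewrite (_ : G0 + d - G0 = d); last by rewrite addrC addKr.
move=> hz.
(* [hz] expands to [|d|^2 + 2 t <d, e + G0> <= 0]. The bound [t <= 1/2] keeps half of [|d|^2], which
   together with [|2 t e + d|^2 >= 0] absorbs the cross term [<d, e>]. *)
have y0 := dot_ge0 (2 * t *: e + d); have d0 := dot_ge0 d.
rewrite -(ler_pM2l t0).
move: hz y0; rewrite !dotE !(dotC d) !(dotC G0 e).
have td : t * dot d d <= 2^-1 * dot d d by rewrite ler_wpM2r.
move: td d0; move: (dot d d) (dot e e) (dot G0 G0) (dot e d) (dot G0 d) (dot e G0).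
move=> dd ee gg ed gd eg; lra.
Qed.

(** The residual attains its minimum on the compact set of bounded points at distance at least [eta]
    from the fixed points, and that minimum is not 0. No rate comes out, so this serves the almost
    sure part only. *)
Lemma residual_gap (r eta : R) : [set u | h u = u] !=set0 -> 0 < eta ->
  exists2 delta, 0 < delta & forall u, eucl_norm u <= r ->
    eta <= eucl_dist u [set v | h v = v] -> delta <= eucl_norm (h u - u).
Proof.
move=> F0 eta0; set F := [set v | h v = v] in F0 *.
pose K := [set u | eucl_norm u <= r] `&` [set u | - eucl_dist u F <= - eta].
have [[u0 Ku0]|Kempty] := pselect (K !=set0); last first.
  exists 1 => // u ur ud; exfalso; apply: Kempty; exists u; split => //=.
  by rewrite lerN2.
have cK : compact K.
  apply: bounded_closed_compact.
    by apply: (@eucl_bounded_set _ _ _ r) => u [].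
  apply: closedI.
    apply: (@eucl_lipschitz_closed_le _ _ 1) => u v.
    by rewrite mul1r ler_eucl_dist_dist.
  apply: (@eucl_lipschitz_closed_le _ _ 1) => u v.
  rewrite -opprD normrN; exact: (eucl_dist_lipschitz F0 closed_fixpoints u v).
have cN : {within K, continuous (fun u => eucl_norm (h u - u))}.
  by apply: continuous_subspaceT; exact: eucl_lipschitz_continuous residual_norm_lipschitz.
have [p] := compact_EVT_min (ex_intro _ u0 Ku0) cK cN.
rewrite inE => -[/= pr pd] pmin; exists (eucl_norm (h p - p)).
  rewrite lt_neqAle eucl_norm_ge0 andbT; apply/negP => /eqP/esym/eucl_norm_eq0/eqP.
  rewrite subr_eq0 => /eqP Fp; move: pd.
  rewrite (eucl_dist_proj F0 closed_fixpoints).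
  rewrite (eucl_proj_id F0 closed_fixpoints convex_fixpoints p Fp) subrr eucl_norm0.
  by rewrite lerN2 leNgt eta0.
by move=> u ur ud; apply: pmin; rewrite inE; split => //=; rewrite lerN2.
Qed.

End nonexpansive.

(** * Pathwise one-step inequalities for the fast and slow maps *)

Section two_time_scale_maps.
Context {R : realType} {d1 d2 : nat} (X : set 'rV[R]_d1)
  (f : 'rV[R]_d1 -> 'rV[R]_d2 -> 'rV[R]_d1)
  (g : 'rV[R]_d1 -> 'rV[R]_d2 -> 'rV[R]_d2) (mu L c1 : R).
Hypotheses (X_nonempty : X !=set0) (X_closed : closed X)
  (X_convex : @convex_set R 'rV[R]_d1 X)
  (X_bounded : exists B : R, forall u, X u -> eucl_norm u <= B)
  (mu_bounds : 0 <= mu < 1)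
  (f_contraction : forall x1 x2 y',
     eucl_norm (f x1 y' - f x2 y') <= mu * eucl_norm (x1 - x2))
  (g_nonexpansive : forall y1 y2,
     eucl_norm (g (xhat X f y1) y1 - g (xhat X f y2) y2)
       <= eucl_norm (y1 - y2))
  (L_gt0 : 0 < L) (c1_gt0 : 0 < c1)
  (fg_lipschitz : forall x1 x2 y1 y2,
     eucl_norm (f x1 y1 - f x2 y2) + eucl_norm (g x1 y1 - g x2 y2)
       <= L * (eucl_norm (x1 - x2) + eucl_norm (y1 - y2)))
  (fg_growth : forall x' y',
     eucl_norm (f x' y') + eucl_norm (g x' y')
       <= c1 * (1 + eucl_norm x' + eucl_norm y')).
Implicit Types (x u : 'rV[R]_d1) (y z : 'rV[R]_d2).

Let mu_ge0 : 0 <= mu. Proof. by case/andP: mu_bounds. Qed.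
Let mu_lt1 : mu < 1. Proof. by case/andP: mu_bounds. Qed.

Lemma f_lipschitz x1 x2 y1 y2 : eucl_norm (f x1 y1 - f x2 y2) <=
  L * (eucl_norm (x1 - x2) + eucl_norm (y1 - y2)).
Proof. by apply: le_trans (fg_lipschitz x1 x2 y1 y2); rewrite lerDl. Qed.

Lemma g_lipschitz x1 x2 y1 y2 : eucl_norm (g x1 y1 - g x2 y2) <=
  L * (eucl_norm (x1 - x2) + eucl_norm (y1 - y2)).
Proof. by apply: le_trans (fg_lipschitz x1 x2 y1 y2); rewrite lerDr. Qed.

Lemma proj_f_contraction y x1 x2 :
  eucl_norm (eucl_proj X (f x1 y) - eucl_proj X (f x2 y)) <=
    mu * eucl_norm (x1 - x2).
Proof.
apply: le_trans (f_contraction x1 x2 y).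
exact: eucl_proj_nonexpansive X_nonempty X_closed X_convex _ _.
Qed.

(* The displacement |x - P_X (f x y)| attains its minimum on the compact set X;
   applying the contraction to the minimiser shows that the minimum is 0. *)
Lemma xhatP y : xhat X f y = eucl_proj X (f (xhat X f y) y).
Proof.
pose S x := eucl_proj X (f x y).
have XS x : X (S x) by have [] := eucl_projP X_nonempty X_closed (f x y).
suff [p pS] : exists p, p = S p by rewrite /xhat; case: xgetP => [q _ //|/(_ p)].
pose phi x := eucl_norm (x - S x).
have philip u v : `|phi u - phi v| <= (1 + mu) * eucl_norm (u - v).
  rewrite (le_trans (ler_eucl_dist_dist _ _))//.
  rewrite (_ : _ - _ = (u - v) - (S u - S v)); last first.
    by apply/rowP => j; rewrite !mxE; ring.
  rewrite (le_trans (ler_eucl_normD _ _))// eucl_normN mulrDl mul1r lerD2l.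
  exact: proj_f_contraction.
have cA : compact X.
  case: X_bounded => B XB.
  by apply: bounded_closed_compact => //; exact: eucl_bounded_set XB.
have cphi : {within X, continuous phi}.
  by apply: continuous_subspaceT; exact: eucl_lipschitz_continuous philip.
have [p Xp pmin] := compact_EVT_min X_nonempty cA cphi.
exists p; apply/eqP; rewrite -subr_eq0; apply/eqP/eucl_norm_eq0.
have h1 := proj_f_contraction y p (S p); have := pmin _ (mem_set (XS p)).
rewrite -/(S p) -/(S (S p)) in h1; rewrite /phi => /le_trans/(_ h1) h2.
apply/eqP; rewrite eq_le eucl_norm_ge0 andbT leNgt; apply/negP => h3.
by move: h2; rewrite leNgt gtr_pMl ?mu_lt1.
Qed.

(** Passing through [f u2 y1] gives [|u1 - u2| <= mu |u1 - u2| + L |y1 - y2|] for the two fixed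
    points. *)
Lemma xhat_lipschitz y1 y2 : eucl_norm (xhat X f y1 - xhat X f y2) <=
  L / (1 - mu) * eucl_norm (y1 - y2).
Proof.
rewrite mulrAC ler_pdivlMr ?subr_gt0//.
have := eucl_proj_nonexpansive X_nonempty X_closed X_convex
  (f (xhat X f y1) y1) (f (xhat X f y2) y2).
rewrite -!xhatP; move: (xhat X f y1) (xhat X f y2) => u1 u2.
have := ler_eucl_normB (f u1 y1) (f u2 y2) (f u2 y1).
have := f_contraction u1 u2 y1.
have := f_lipschitz u2 u2 y1 y2; rewrite subrr eucl_norm0 add0r.
move: (eucl_norm (u1 - u2)) (eucl_norm (y1 - y2)) => a b.
move: (eucl_norm (f u1 y1 - f u2 y1)) (eucl_norm (f u1 y1 - f u2 y2)) => c d.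
by move: (eucl_norm (f u2 y1 - f u2 y2)) => e; lra.
Qed.

Let h y := g (xhat X f y) y.

(** The noise-free relaxed step from [x] minus the one from [xhat X f y], before projection: the
    vector against which the noise is paired. *)
Definition fast_direction (s : R) x y :=
  (1 - s) *: (x - xhat X f y) + s *: (f x y - f (xhat X f y) y).

(** The noise-free part of the next [y], seen from [p]; it plays the same role for the slow
    noise. *)
Definition slow_direction (t : R) p x y :=
  (y - p) + t *: (g x y - y).

Lemma fast_direction_le (s : R) x y : 0 <= s <= 1 ->
  eucl_norm (fast_direction s x y) <=
    (1 - (1 - mu) * s) * eucl_norm (x - xhat X f y).
Proof.
move=> /andP[s0 s1]; rewrite (le_trans (ler_eucl_normD _ _))// !eucl_normZ.
rewrite (ger0_norm s0) ger0_norm ?subr_ge0//.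
have := ler_wpM2l s0 (f_contraction x (xhat X f y) y).
by move: (eucl_norm _) (eucl_norm _) => d e; lra.
Qed.

Lemma drift_growth x y :
  eucl_norm (g x y - y) ^+ 2 <=
    3 * (c1 + 1) ^+ 2 * (1 + eucl_norm x ^+ 2 + eucl_norm y ^+ 2).
Proof.
have h1 : eucl_norm (g x y - y) <= (c1 + 1) * (1 + eucl_norm x + eucl_norm y).
  rewrite (le_trans (ler_eucl_normD _ _))// eucl_normN mulrDl mul1r lerD//.
    by apply: le_trans (fg_growth x y); rewrite lerDr.
  by rewrite lerDr addr_ge0.
have p0 : 0 <= c1 + 1 by rewrite addr_ge0// ltW.
rewrite (@le_trans _ _ ((c1 + 1) ^+ 2 * (1 + eucl_norm x + eucl_norm y) ^+ 2))//.
  by rewrite -exprMn ler_pXn2r// ?nnegrE ?mulr_ge0// !addr_ge0.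
have := ler_wpM2l (sqr_ge0 (c1 + 1)) (ler_sqr_sum3 1 (eucl_norm x) (eucl_norm y)).
rewrite expr1n; move: (_ ^+ 2) (_ ^+ 2) (_ ^+ 2) (_ ^+ 2) => *; lra.
Qed.

(** The new error splits at [xhat X f y]. Young's inequality with weight [c * s], [c = 1 - mu],
    costs a factor [1 + c * s] on the contracted part, and [(1 + c s) (1 - c s)^2 <= 1 - c s]. The
    displacement of [xhat] costs [(1 + 1 / (c s)) t^2], of order [s^2] because [t^2 <= s^3]. The
    product with [u] is kept as it is, since only its integral vanishes. *)
Lemma fast_step : exists2 C : R, 0 < C & forall (s t : R) x y u z,
  0 < s <= 1 -> 0 < t -> t ^+ 2 <= s ^+ 3 ->
  eucl_norm (eucl_proj X (x + s *: (f x y - x + u)) -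
             xhat X f (y + t *: (g x y - y + z))) ^+ 2 <=
  (1 - (1 - mu) * s) * eucl_norm (x - xhat X f y) ^+ 2
  + 2 * s * (1 + (1 - mu) * s) * dot (fast_direction s x y) u
  + C * s ^+ 2 * (1 + eucl_norm x ^+ 2 + eucl_norm y ^+ 2
                  + eucl_norm u ^+ 2 + eucl_norm z ^+ 2).
Proof.
have [c cE] : exists c, c = 1 - mu by exists (1 - mu).
have c0 : 0 < c by rewrite cE subr_gt0.
have c1' : c <= 1 by rewrite cE lerBlDr lerDl.
(* The factors come from [1 + (c s)^-1 <= 2 (c s)^-1], from the Lipschitz constant of [xhat], and
   from the growth of the drift plus slow noise. *)
pose K := 2 / c * (L / c) ^+ 2 * (6 * (c1 + 1) ^+ 2 + 2).
have q0 : 0 <= (c1 + 1) ^+ 2 by rewrite sqr_ge0.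
have K0 : 0 <= K.
  rewrite /K mulr_ge0// ?addr_ge0 ?(mulr_ge0 _ q0)//.
  by rewrite mulr_ge0 ?sqr_ge0// divr_ge0// ltW.
exists (2 + K); first by rewrite ltr_wpDr.
move=> s t x y u z /andP[s0 s1] t0 ts; rewrite -cE.
set xh := xhat X f y; set v := fast_direction s x y.
set x1 := eucl_proj X _; set y1 := y + _.
have xhE : xh = eucl_proj X (xh + s *: (f xh y - xh)).
  rewrite (@eucl_proj_fixed_relax _ _ _ _ _ _ s xh (f xh y))//.
  - exact: ltW.
  - exact: xhatP.
have N1 : eucl_norm (x1 - xh) ^+ 2 <= eucl_norm (v + s *: u) ^+ 2.
  rewrite ler_pXn2r// ?nnegrE// [in leLHS]xhE.
  rewrite (le_trans (eucl_proj_nonexpansive X_nonempty X_closed X_convex _ _))//.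
  rewrite (_ : _ - _ = v + s *: u)// /v /fast_direction -/xh.
  by apply/rowP => j; rewrite !mxE; ring.
have N2 : eucl_norm (v + s *: u) ^+ 2 =
    eucl_norm v ^+ 2 + 2 * s * dot v u + s ^+ 2 * eucl_norm u ^+ 2.
  by rewrite sqr_eucl_normD sqr_eucl_normZ dotZr; ring.
have cs0 : 0 < c * s by rewrite mulr_gt0.
have cs1 : c * s <= 1 by rewrite mulr_ile1// ltW.
have N3 : eucl_norm v ^+ 2 <= (1 - c * s) ^+ 2 * eucl_norm (x - xh) ^+ 2.
  rewrite -exprMn ler_pXn2r// ?nnegrE// ?mulr_ge0// ?subr_ge0//.
  by rewrite cE; apply: fast_direction_le; rewrite ltW.
have N4 : eucl_norm (xh - xhat X f y1) ^+ 2 <=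
    (L / c) ^+ 2 * (t ^+ 2 * eucl_norm (g x y - y + z) ^+ 2).
  rewrite -!exprMn ler_pXn2r// ?nnegrE// ?mulr_ge0 ?invr_ge0 ?(ltW c0) ?(ltW t0) ?(ltW L_gt0)//.
  rewrite (le_trans (xhat_lipschitz y y1))// -cE.
  rewrite ler_wpM2l ?divr_ge0 ?(ltW c0) ?(ltW L_gt0)//.
  by rewrite /y1 opprD addNKr eucl_normN eucl_normZ gtr0_norm.
have N5 : eucl_norm (g x y - y + z) ^+ 2 <=
    6 * (c1 + 1) ^+ 2 * (1 + eucl_norm x ^+ 2 + eucl_norm y ^+ 2) + 2 * eucl_norm z ^+ 2.
  have := sqr_eucl_normD_le2 (g x y - y) z; have := drift_growth x y; clear N1 N2 N3 N4.
  move: (eucl_norm (g x y - y + z)) (eucl_norm (g x y - y)) => A B.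
  by move: (eucl_norm x) (eucl_norm y) (eucl_norm z) => *; lra.
have -> : x1 - xhat X f y1 = (x1 - xh) + (xh - xhat X f y1) by rewrite addrA subrK.
rewrite (le_trans (sqr_eucl_normD_le _ _ _ cs0))//.
have N6 : (1 + (c * s)^-1) * eucl_norm (xh - xhat X f y1) ^+ 2 <=
    K * s ^+ 2 * (1 + eucl_norm x ^+ 2 + eucl_norm y ^+ 2 + eucl_norm z ^+ 2).
  have M1 : 1 + (c * s)^-1 <= 2 * (c * s)^-1.
    have : 1 <= (c * s)^-1 by rewrite invf_ge1.
    clear N1 N2 N3 N4 N5 cs0 cs1.
    by move: (_^-1) => *; lra.
  rewrite (le_trans (ler_wpM2r (sqr_ge0 _) M1))//.
  have M2 : 0 <= 2 * (c * s)^-1 by rewrite mulr_ge0// invr_ge0 ltW.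
  rewrite (le_trans (ler_wpM2l M2 N4))//.
  have -> : 2 * (c * s)^-1 * ((L / c) ^+ 2 * (t ^+ 2 * eucl_norm (g x y - y + z) ^+ 2)) =
      2 / c * (L / c) ^+ 2 * (t ^+ 2 / s) * eucl_norm (g x y - y + z) ^+ 2.
    by field; rewrite !gt_eqF.
  have M3 : t ^+ 2 / s <= s ^+ 2 by rewrite ler_pdivrMr// -exprSr.
  set k := 2 / c * (L / c) ^+ 2.
  have k0 : 0 <= k by rewrite mulr_ge0 ?sqr_ge0// divr_ge0// ltW.
  rewrite (@le_trans _ _ (k * s ^+ 2 * eucl_norm (g x y - y + z) ^+ 2))//.
    by rewrite ler_wpM2r ?sqr_ge0// ler_wpM2l.
  have -> S : K * s ^+ 2 * S = k * s ^+ 2 * ((6 * (c1 + 1) ^+ 2 + 2) * S).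
    by rewrite /K -/k; ring.
  have ks0 : 0 <= k * s ^+ 2 by apply: mulr_ge0 => //; exact: sqr_ge0.
  rewrite (ler_wpM2l ks0)// (le_trans N5)//.
  have := sqr_ge0 (eucl_norm x); have := sqr_ge0 (eucl_norm y); have := sqr_ge0 (eucl_norm z).
  move: q0; clear N1 N2 N3 N4 N5 cs0 cs1 M1 M2 M3.
  move: ((c1 + 1) ^+ 2) (eucl_norm x ^+ 2) (eucl_norm y ^+ 2) (eucl_norm z ^+ 2) => q xx yy zz q0 z0 y0 x0.
  have : 0 <= q * zz by rewrite mulr_ge0.
  by lra.
rewrite (@le_trans _ _ ((1 + c * s) * (eucl_norm v ^+ 2 + 2 * s * dot v u + s ^+ 2 * eucl_norm u ^+ 2) +
   K * s ^+ 2 * (1 + eucl_norm x ^+ 2 + eucl_norm y ^+ 2 + eucl_norm z ^+ 2)))//.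
  by rewrite lerD// -N2 ler_wpM2l// addr_ge0// ltW.
have N7 : (1 + c * s) * eucl_norm v ^+ 2 <= (1 - c * s) * eucl_norm (x - xh) ^+ 2.
  have p0 : 0 <= 1 + c * s by rewrite addr_ge0// ltW.
  rewrite (le_trans (ler_wpM2l p0 N3))// mulrA ler_wpM2r ?sqr_ge0//.
  have : 0 <= (1 - c * s) * (c * s) ^+ 2 by rewrite mulr_ge0 ?sqr_ge0 ?subr_ge0.
  by clear N1 N2 N3 N4 N5 N6 cs0 cs1; move: (c * s) => *; lra.
have N8 : (1 + c * s) * (s ^+ 2 * eucl_norm u ^+ 2) <= 2 * (s ^+ 2 * eucl_norm u ^+ 2).
  apply: ler_wpM2r; first exact: mulr_ge0 (sqr_ge0 _) (sqr_ge0 _).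
  by move: cs1; clear N1 N2 N3 N4 N5 N6 N7 cs0; move: (c * s) => *; lra.
have : 0 <= s ^+ 2 * (1 + eucl_norm x ^+ 2 + eucl_norm y ^+ 2 + eucl_norm z ^+ 2).
  by apply: mulr_ge0; rewrite ?addr_ge0 ?sqr_ge0.
have : 0 <= K * (s ^+ 2 * eucl_norm u ^+ 2).
  by apply: mulr_ge0 => //; apply: mulr_ge0; exact: sqr_ge0.
move: N7 N8; clearbody K; clear N1 N2 N3 N4 N5 N6 cs0 cs1.
move: (eucl_norm _ ^+ 2) (eucl_norm _ ^+ 2) (eucl_norm _ ^+ 2) (eucl_norm _ ^+ 2) (eucl_norm _ ^+ 2) (eucl_norm _ ^+ 2).
move: (dot _ _) (s ^+ 2) => *; lra.
Qed.

(** Against the fixed point [p], nonexpansiveness gives [2 <y - p, r> + |r|^2 <= 0] for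
    [r = h y - y], and [t <= 1/2] leaves the decrease [t / 2 |r|^2]. Replacing [h y] by [g x y] uses
    Young's inequality with weight [s^2]: the factor [(1 + s^-2) t^2] is at most [2 s], so the
    tracking error enters with [s] rather than [t]. *)
Lemma slow_step (s t : R) x y z p : Yhat X f g p ->
  0 < s <= 1 -> 0 < t <= 2^-1 -> t ^+ 2 <= s ^+ 3 ->
  eucl_norm (y + t *: (g x y - y + z) - p) ^+ 2 <=
  (1 + s ^+ 2) * eucl_norm (y - p) ^+ 2 - t / 2 * eucl_norm (h y - y) ^+ 2
  + 2 * L ^+ 2 * s * eucl_norm (x - xhat X f y) ^+ 2
  + 2 * t * dot (slow_direction t p x y) z + t ^+ 2 * eucl_norm z ^+ 2.
Proof.
move=> hp /andP[s0 s1] /andP[t0 t1] ts.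
set w := (y - p) + t *: (h y - y); set e := g x y - h y.
have dirE : slow_direction t p x y = w + t *: e.
  by rewrite /slow_direction /w /e; apply/rowP => j; rewrite !mxE; ring.
have -> : y + t *: (g x y - y + z) - p = slow_direction t p x y + t *: z.
  by rewrite /slow_direction; apply/rowP => j; rewrite !mxE; ring.
set v := slow_direction t p x y in dirE *.
have E1 : eucl_norm (v + t *: z) ^+ 2 =
    eucl_norm v ^+ 2 + 2 * t * dot v z + t ^+ 2 * eucl_norm z ^+ 2.
  by rewrite sqr_eucl_normD sqr_eucl_normZ dotZr; ring.
have s20 : 0 < s ^+ 2 by rewrite exprn_gt0.
have s21 : s ^+ 2 <= 1 by rewrite exprn_ile1// ltW.
have E2 : eucl_norm v ^+ 2 <= (1 + s ^+ 2) * eucl_norm w ^+ 2 +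
    2 * L ^+ 2 * s * eucl_norm (x - xhat X f y) ^+ 2.
  rewrite dirE (le_trans (sqr_eucl_normD_le _ _ _ s20))// lerD2l.
  rewrite eucl_normZ exprMn (gtr0_norm t0).
  have F1 : 1 + (s ^+ 2)^-1 <= 2 * (s ^+ 2)^-1.
    have : 1 <= (s ^+ 2)^-1 by rewrite invf_ge1.
    by move: (_^-1) => *; lra.
  have F2 : eucl_norm e ^+ 2 <= L ^+ 2 * eucl_norm (x - xhat X f y) ^+ 2.
    rewrite -exprMn ler_pXn2r// ?nnegrE ?mulr_ge0 ?(ltW L_gt0)//.
    by have := g_lipschitz x (xhat X f y) y y; rewrite subrr eucl_norm0 addr0.
  have F3 : (1 + (s ^+ 2)^-1) * t ^+ 2 <= 2 * s.
    rewrite (le_trans (ler_wpM2r (sqr_ge0 t) F1))// -mulrA ler_pM2l//.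
    by rewrite ler_pdivrMl// -exprSr.
  rewrite mulrA (le_trans (ler_wpM2r (sqr_ge0 _) F3))//.
  have -> A : 2 * L ^+ 2 * s * A = 2 * s * (L ^+ 2 * A) by ring.
  by rewrite ler_wpM2l// mulr_ge0// ltW.
have E3 : eucl_norm w ^+ 2 <= eucl_norm (y - p) ^+ 2 - t / 2 * eucl_norm (h y - y) ^+ 2.
  have hyp : eucl_norm (h y - p) <= eucl_norm (y - p).
    by rewrite -[X in h y - X]hp; exact: g_nonexpansive.
  rewrite -(@ler_pXn2r _ 2 isT) ?nnegrE// !eucl_norm_sqr in hyp.
  rewrite /w !eucl_norm_sqr; have r0 := dot_ge0 (h y - y).
  have hyE : h y - p = (y - p) + (h y - y) by rewrite [RHS]addrC addrA subrK.
  rewrite hyE in hyp; move: (y - p) (h y - y) hyp r0 => A r.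
  rewrite !dotE !(dotC r A); move: (dot A A) (dot r r) (dot A r) => aa rr ar H1 H2.
  have : t * (2 * ar + rr) <= 0 by rewrite mulr_ge0_le0 ?(ltW t0)//; lra.
  have : t * (t * rr) <= t * (2^-1 * rr) by rewrite ler_wpM2l ?(ltW t0)// ler_wpM2r.
  lra.
rewrite E1.
have := ler_wpM2l (ltW s20) E3.
have : 0 <= s ^+ 2 * (t / 2 * eucl_norm (h y - y) ^+ 2).
  by rewrite !mulr_ge0 ?sqr_ge0// ?invr_ge0 ltW.
move: E2 E3; clear E1.
move: (eucl_norm _ ^+ 2) (eucl_norm _ ^+ 2) (eucl_norm _ ^+ 2) (eucl_norm _ ^+ 2) (eucl_norm _ ^+ 2) (eucl_norm _ ^+ 2).
move: (dot _ _) (s ^+ 2) => *; lra.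
Qed.

End two_time_scale_maps.

(** * Step sizes and real recursions *)

Section step_sizes.
Context {R : realType}.
Implicit Types (a c e r s u K : R).

Lemma powR_1D_lower a u : 0 <= a -> 0 <= u -> 1 - a * u <= (1 + u) `^ (- a).
Proof.
move=> a0 u0; rewrite /powR gt_eqF ?ltr_wpDr//.
apply: le_trans (expR_ge1Dx _); rewrite mulNr lerD2l lerN2 ler_wpM2l//.
by apply: le_ln1Dx; rewrite (lt_le_trans _ u0)// ltrN10.
Qed.

Lemma ln1D_lower u : 0 <= u <= 1 -> u / 2 <= ln (1 + u).
Proof.
move=> /andP[u0 u1]; have p0 : 0 < 1 + u by rewrite ltr_wpDr.
rewrite -[1 + u]invrK lnV ?posrE ?invr_gt0// lerNr.
have -> : (1 + u)^-1 = 1 + (- (u / (1 + u))) by field; rewrite gt_eqF.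
apply: (le_trans (le_ln1Dx _)).
  by rewrite ltrN2 ltr_pdivrMr// mul1r ltrDr.
by rewrite lerN2 ler_wpM2l// lef_pV2 ?posrE//; lra.
Qed.

(** A lower bound on the decrements of a negative power. One factor 1/2 comes from
    [ln (1 + u) >= u / 2], the other from [(1 + y)^-1 <= 1 - y / 2] on [0, 1]. *)
Lemma powR_1D_upper s u : 0 <= s <= 1 -> 0 <= u <= 1 ->
  (1 + u) `^ (- s) <= 1 - s * u / 4.
Proof.
move=> /andP[s0 s1] /andP[u0 u1]; rewrite /powR gt_eqF ?ltr_wpDr//.
rewrite mulNr expRN.
pose y := s * (u / 2).
have y0 : 0 <= y by rewrite /y mulr_ge0// divr_ge0.
have su1 : s * u <= 1 by rewrite mulr_ile1.
have y1 : y <= 1 by rewrite /y; lra.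
have h : 1 + y <= expR (s * ln (1 + u)).
  apply: le_trans (expR_ge1Dx _); rewrite lerD2l /y ler_wpM2l//.
  by apply: ln1D_lower; rewrite u0 u1.
apply: (@le_trans _ _ (1 + y)^-1).
  by rewrite lef_pV2 ?posrE ?expR_gt0// ltr_wpDr.
have p0 : 0 < 1 + y by rewrite ltr_wpDr.
rewrite -(ler_pM2r p0) mulVf ?gt_eqF//.
have -> : s * u / 4 = y / 2 by rewrite /y; field.
have : 0 <= y * (1 - y) by rewrite mulr_ge0// subr_ge0.
by clearbody y; lra.
Qed.

Lemma cvg_powR_inv e : 0 < e -> (k.+1%:R `^ e)^-1 @[k --> \oo] --> (0 : R).
Proof.
move=> e0; apply/cvgrPdist_le => eps eps0; near=> k.
rewrite sub0r normrN ger0_norm ?invr_ge0 ?powR_ge0//.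
rewrite -[eps]invrK lef_pV2 ?posrE ?powR_gt0 ?invr_gt0//.
have -> : eps^-1 = (eps^-1 `^ e^-1) `^ e.
  by rewrite -powRrM mulVf ?gt_eqF// powRr1// invr_ge0 ltW.
apply: (ge0_ler_powR (ltW e0)); rewrite ?nnegrE ?powR_ge0//.
rewrite (le_trans _ (_ : k%:R <= _)) ?ler_nat//.
near: k; exact: nbhs_infty_ger.
Unshelve. all: end_near. Qed.

Definition shifted_index K (k : nat) : R := k%:R + K.

Lemma shifted_indexS K k : shifted_index K k.+1 = shifted_index K k + 1.
Proof. by rewrite /shifted_index -natr1; ring. Qed.

Section one_sequence.
Variables (c e K : R).
Hypotheses (c0 : 0 < c) (e0 : 0 < e) (K1 : 1 <= K).
Let n k := shifted_index K k.
Let st k := step_size c e K k.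

Lemma shift_ge1 k : 1 <= n k.
Proof. by rewrite /n /shifted_index ler_wpDl. Qed.
Local Hint Resolve shift_ge1 : core.

Lemma shift_gt0 k : 0 < n k.
Proof. exact: lt_le_trans (shift_ge1 k). Qed.
Local Hint Resolve shift_gt0 : core.

Lemma step_gt0 k : 0 < st k.
Proof. by rewrite divr_gt0// powR_gt0// shift_gt0. Qed.
Local Hint Resolve step_gt0 : core.

Lemma step_le k : st k <= c.
Proof.
rewrite ler_pdivrMr ?powR_gt0 ?shift_gt0// ler_peMr ?(ltW c0)//.
by rewrite -[leLHS](@powRr0 _ (n k)); apply: ler_powR; [exact: shift_ge1|exact: ltW].
Qed.

Lemma step_le_powR k : st k <= c / k.+1%:R `^ e.
Proof.
rewrite ler_pM2l// lef_pV2 ?posrE ?powR_gt0 ?shift_gt0//.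
apply: ge0_ler_powR; rewrite ?nnegrE ?(ltW e0) ?(ltW (shift_gt0 _))//.
by rewrite -natr1 /shifted_index lerD2l.
Qed.

Lemma stepE k : st k = c * n k `^ (- e).
Proof. by rewrite /st /step_size powRN. Qed.

Lemma shift_powRS r k : n k.+1 `^ r = n k `^ r * (1 + (n k)^-1) `^ r.
Proof.
rewrite -powRM ?(ltW (shift_gt0 _))//; last by rewrite addr_ge0// invr_ge0 (ltW (shift_gt0 _)).
by rewrite /n shifted_indexS mulrDr mulr1 divff// gt_eqF ?shift_gt0.
Qed.

Lemma shift_powRD r s k : n k `^ (r + s) = n k `^ r * n k `^ s.
Proof. by apply: powRD; apply/implyP => _; rewrite gt_eqF ?shift_gt0. Qed.

Lemma step_decrease rho k : 0 < rho -> e < 1 ->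
  (2 * e / (rho * c)) `^ (1 - e)^-1 <= K ->
  st k - st k.+1 <= rho / 2 * st k ^+ 2.
Proof.
move=> r0 e1 hK.
have n0 := shift_gt0 k; have ni : 0 <= (n k)^-1 by rewrite invr_ge0 ltW.
have h1 : (1 - e * (n k)^-1) * st k <= st k.+1.
  rewrite !stepE shift_powRS mulrC [leRHS]mulrA ler_wpM2l//.
    by rewrite mulr_ge0 ?powR_ge0// ltW.
  exact: powR_1D_lower (ltW e0) ni.
have h2 : 2 * e / (rho * c) <= n k `^ (1 - e).
  have z0 : 0 <= 2 * e / (rho * c) by rewrite divr_ge0 ?mulr_ge0// ltW.
  have -> : 2 * e / (rho * c) = ((2 * e / (rho * c)) `^ (1 - e)^-1) `^ (1 - e).
    by rewrite -powRrM mulVf ?powRr1// gt_eqF// subr_gt0.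
  apply: ge0_ler_powR; rewrite ?nnegrE ?powR_ge0 ?subr_ge0 ?(ltW e1) ?(ltW n0)//.
  by rewrite (le_trans hK)// /n /shifted_index lerDr.
have h3 : e * (n k)^-1 <= rho / 2 * st k.
  rewrite ler_pdivrMr// in h2; last by rewrite mulr_gt0.
  rewrite ler_pdivrMr// stepE.
  have -> : rho / 2 * (c * n k `^ (- e)) * n k = 2^-1 * (n k `^ (1 - e) * (rho * c)).
    by rewrite shift_powRD powRr1 ?(ltW n0)//; ring.
  lra.
have := ler_wpM2r (ltW (step_gt0 k)) h3.
lra.
Qed.

(** [T] majorises the remainders of the series of squared steps. It is the power of [n k] of
    exponent [1 - 2 e], with [D] chosen so that [D * s / 4 = c ^+ 2] matches the guaranteed
    decrement. *)
Lemma sqr_step_tail : 2^-1 < e -> e < 1 -> exists T : nat -> R,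
  [/\ forall k, 0 <= T k, forall k, st k ^+ 2 + T k.+1 <= T k &
      T k @[k --> \oo] --> (0 : R)].
Proof.
move=> e2 e1; pose s := 2 * e - 1.
have s0 : 0 < s by rewrite /s; lra.
have s1 : s <= 1 by rewrite /s; lra.
pose D := 4 * c ^+ 2 / s.
have D0 : 0 <= D by rewrite divr_ge0 ?(ltW s0)// mulr_ge0// sqr_ge0.
exists (fun k => D * n k `^ (- s)); split=> [k|k|].
- by rewrite mulr_ge0// powR_ge0.
- have n0 := shift_gt0 k; have ni : 0 <= (n k)^-1 <= 1.
    by rewrite invr_ge0 (ltW n0) invf_le1//= shift_ge1.
  have h := @powR_1D_upper s (n k)^-1 _ ni; rewrite (ltW s0) s1 in h.
  have {}h := ler_wpM2l (powR_ge0 (n k) (- s)) (h isT).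
  have {}h := ler_wpM2l D0 h; rewrite -shift_powRS in h.
  have -> : st k ^+ 2 = D * (n k `^ (- s) * (s * (n k)^-1 / 4)).
    rewrite stepE exprMn -(powR_mulrn 2 (powR_ge0 _ _)) -powRrM.
    have -> : - e * 2%:R = - s + (- 1) by rewrite /s; ring.
    rewrite shift_powRD powR_inv1 ?(ltW n0)// /D; field.
    by rewrite !gt_eqF.
  lra.
- rewrite -[X in _ --> X](mulr0 D); apply: cvgMr.
  apply: (@squeeze_cvgr _ _ _ _ (fun=> 0) (fun k => (k.+1%:R `^ s)^-1)); last 2 first.
  + exact: cvg_cst.
  + exact: cvg_powR_inv.
  near=> k; rewrite powR_ge0 powRN/= lef_pV2 ?posrE ?powR_gt0 ?shift_gt0//.
  apply: ge0_ler_powR; rewrite ?nnegrE ?(ltW s0) ?(ltW (shift_gt0 _))//.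
  by rewrite -natr1 /n /shifted_index lerD2l.
Unshelve. all: end_near. Qed.

(** If [D >= 2 * C / rho], the bound [D * st k] becomes at most [D * (st k - rho / 2 * st k ^+ 2)],
    which [step_decrease] puts below [D * st k.+1]. The other term of the maximum starts the
    induction; [rho * c <= 1] keeps the contraction factor nonnegative. *)
Lemma step_recursion (C rho : R) (E : nat -> R) : 0 < rho -> 0 <= C -> e < 1 ->
  rho * c <= 1 -> (2 * e / (rho * c)) `^ (1 - e)^-1 <= K ->
  (forall k, E k.+1 <= (1 - rho * st k) * E k + C * st k ^+ 2) ->
  exists2 D, 0 <= D & forall k, E k <= D * st k.
Proof.
move=> r0 C0 e1 rc hK hE.
pose D := Num.max (2 * C / rho) (E 0 / st 0).
have D1 : 2 * C / rho <= D by rewrite /D le_max lexx.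
have D0 : 0 <= D by apply: le_trans D1; rewrite divr_ge0 ?mulr_ge0// ltW.
exists D => //; elim=> [|k IH].
  by rewrite -ler_pdivrMr// /D le_max lexx orbT.
apply: le_trans (hE k) _.
have rs : 0 <= 1 - rho * st k.
  by rewrite subr_ge0 (le_trans _ rc)// ler_pM2l// step_le.
have h1 := ler_wpM2l rs IH.
have h2 := ler_wpM2l D0 (@step_decrease rho k r0 e1 hK).
rewrite ler_pdivrMr// in D1.
have h3 := ler_wpM2r (sqr_ge0 (st k)) D1.
move: h1 h2 h3; clearbody D; clear; move: (st k) (st k.+1) (E k) => *; lra.
Qed.

(** The product [n k * st k] acts as the sum of the steps: it grows by at most one step at a time,
    and [shift_step_lower] gives it the same polynomial growth. *)
Lemma shift_step_increase k : n k.+1 * st k.+1 <= n k * st k + st k.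
Proof.
have -> : n k * st k + st k = n k.+1 * st k by rewrite /n shifted_indexS; ring.
rewrite ler_wpM2l ?(ltW (shift_gt0 _))// ler_pM2l// lef_pV2 ?posrE ?powR_gt0 ?shift_gt0//.
apply: ge0_ler_powR; rewrite ?nnegrE ?(ltW e0) ?(ltW (shift_gt0 _))//.
by rewrite lerD2r ler_nat.
Qed.

Lemma shift_step_lower k : e <= 1 -> c * k.+1%:R `^ (1 - e) <= n k * st k.
Proof.
move=> e1; have -> : n k * st k = c * n k `^ (1 - e).
  by rewrite stepE shift_powRD powRr1 ?(ltW (shift_gt0 _))//; ring.
rewrite ler_wpM2l ?(ltW c0)//.
apply: ge0_ler_powR; rewrite ?nnegrE ?subr_ge0 ?(ltW (shift_gt0 _))//.
by rewrite -natr1 /n /shifted_index lerD2l.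
Qed.

Lemma shift_sqr_step k : 2^-1 <= e -> n k * st k ^+ 2 <= c ^+ 2.
Proof.
move=> e2; rewrite stepE exprMn mulrCA ler_piMr ?sqr_ge0//.
rewrite -(powR_mulrn 2 (powR_ge0 _ _)) -powRrM -[X in X * _]powRr1 ?(ltW (shift_gt0 _))//.
rewrite -shift_powRD -[leRHS](@powRr0 _ (n k)); apply: ler_powR; first exact: shift_ge1.
lra.
Qed.

End one_sequence.

(** A discrete Gronwall inequality: [(V k + 1) * expR (C * T k)] is nonincreasing, the remainder [T]
    replacing partial products. *)
Lemma bounded_growth (C : R) (s T V : nat -> R) : 0 <= C ->
  (forall k, 0 <= T k) -> (forall k, s k + T k.+1 <= T k) ->
  (forall k, 0 <= V k) ->
  (forall k, V k.+1 <= (1 + C * s k) * V k + C * s k) ->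
  exists B, forall k, V k <= B.
Proof.
move=> C0 T0 sT V0 hV; exists ((V 0 + 1) * expR (C * T 0)) => k.
suff : (V k + 1) * expR (C * T k) <= (V 0 + 1) * expR (C * T 0).
  apply: le_trans; rewrite (@le_trans _ _ (V k + 1)) ?lerDl// ler_peMr ?addr_ge0//.
  by rewrite -expR0 ler_expR mulr_ge0.
elim: k => [//|k IH]; apply: le_trans IH.
have h1 : V k.+1 + 1 <= (V k + 1) * expR (C * s k).
  apply: (@le_trans _ _ ((V k + 1) * (1 + C * s k))).
    by have := hV k; lra.
  by rewrite ler_wpM2l ?addr_ge0// expR_ge1Dx.
apply: (le_trans (ler_wpM2r (expR_ge0 _) h1)).
rewrite -mulrA -expRD ler_wpM2l ?addr_ge0// ler_expR -mulrDr ler_wpM2l//.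
Qed.

(* The weights w grow by at most t, and the sum of the t k * H k is bounded by
   telescoping D; hence w * Z + 4 * D + const * T is nonincreasing. *)
Lemma weighted_rate (A Cz Cu Cd : R) (w s t T Z H D : nat -> R) :
  0 <= A -> 0 <= Cz -> 0 <= Cu -> 0 <= Cd ->
  (forall k, [/\ 0 <= t k, 0 <= s k & t k <= s k]) ->
  (forall k, t k <= w k) -> (forall k, w k.+1 <= w k + t k) ->
  (forall k, w k * t k * s k <= A * s k ^+ 2) ->
  (forall k, 0 <= T k) -> (forall k, s k ^+ 2 + T k.+1 <= T k) ->
  (forall k, [/\ 0 <= Z k, 0 <= H k & 0 <= D k]) ->
  (forall k, Z k <= 2 * H k + Cu * t k) ->
  (forall k, Z k.+1 <= Z k + Cz * (t k * s k)) ->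
  (forall k, D k.+1 + t k / 2 * H k <= D k + Cd * s k ^+ 2) ->
  exists2 C, 0 <= C & forall k, w k * Z k <= C.
Proof.
move=> A0 Cz0 Cu0 Cd0 ts tw wS wts T0 TS ZHD ZH ZS DS.
(* One term for each error of order [s k ^+ 2]: from [Z <= 2 H + Cu t], from the increment of [Z],
   and from that of [D]. The 4 before [D] in [Psi] makes its decrease [2 t H] cancel the [2 t H]
   produced by the growth of the weight. *)
pose K := Cu + 2 * (Cz * A) + 4 * Cd.
have K0 : 0 <= K by rewrite /K; have := mulr_ge0 Cz0 A0; lra.
pose Psi k := w k * Z k + 4 * D k + K * T k.
have Psi_le k : w k * Z k <= Psi k.
  by have [_ _ D0] := ZHD k; have := mulr_ge0 K0 (T0 k); rewrite /Psi; lra.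
have w0 k : 0 <= w k by have [t0 _ _] := ts k; exact: le_trans (tw k).
have PsiS k : Psi k.+1 <= Psi k.
  have [t0 s0 tsk] := ts k; have [Z0 H0 D0] := ZHD k; have [Z0' _ _] := ZHD k.+1.
  have h1 : w k.+1 * Z k.+1 <= (w k + t k) * (Z k + Cz * (t k * s k)).
    by apply: ler_pM.
  have h2 : t k * Z k <= 2 * t k * H k + Cu * s k ^+ 2.
    apply: (le_trans (ler_wpM2l t0 (ZH k))).
    have : t k * t k <= s k * s k by exact: ler_pM.
    by move/(ler_wpM2l Cu0); rewrite -expr2; lra.
  have h3 : (w k + t k) * (Cz * (t k * s k)) <= 2 * (Cz * A) * s k ^+ 2.
    apply: (@le_trans _ _ (2 * Cz * (w k * t k * s k))).
      have : 0 <= Cz * (t k * s k) by rewrite !mulr_ge0.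
      by move/(fun h => ler_wpM2r h (tw k)); lra.
    have := ler_wpM2l Cz0 (wts k); lra.
  have h4 := ler_wpM2l K0 (TS k); have h5 := DS k.
  move: h1 h2 h3 h4 h5; rewrite /Psi /K; clear.
  move: (w k.+1 * Z k.+1) (s k ^+ 2) => wz ss.
  by move: (w k) (t k) (s k) (Z k) (H k) (D k) (D k.+1) (T k) (T k.+1) => *; lra.
have Psi0 k : Psi k <= Psi 0 by elim: k => // k; exact: le_trans (PsiS k).
exists (Psi 0) => [|k]; last exact: le_trans (Psi_le k) (Psi0 k).
by apply: le_trans (Psi_le 0); have [Z0 _ _] := ZHD 0; exact: mulr_ge0.
Qed.

End step_sizes.

(** * Measurability of random vectors *)

Section random_vectors.
Context {R : realType} {d : measure_display} {T : measurableType d}.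

(* The preimage of ]c, +oo[ is a union of boxes with rational centres. *)
Lemma continuous_random_vector {n} (V : T -> 'rV[R]_n) (phi : 'rV[R]_n -> R) :
  random_vector V -> continuous phi -> measurable_fun [set: T] (phi \o V).
Proof.
move=> mV cphi _; apply: (measurability _ (RGenOInfty.measurableE R)) => //.
move=> /= _ [_ [c ->] <-]; rewrite setTI.
pose box (p : 'rV[rat]_n * nat) (v : 'rV[R]_n) :=
  forall j, `|v ord0 j - ratr (p.1 ord0 j)| < p.2.+1%:R^-1.
(* Boxes not contained in the open set contribute [set0], so the union runs over a whole countable
   type. *)
pose F p := if `[< forall v, box p v -> c < phi v >]
  then [set w | box p (V w)] else set0.
rewrite (_ : _ @^-1` _ = \bigcup_p F p); last first.
  apply/seteqP; split => [w /=|w [p _]]; last first.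
    by rewrite /F; case: asboolP => // bp bVw /=; rewrite in_itv/= andbT; exact: bp.
  rewrite in_itv/= andbT => cVw.
  have : \forall v \near V w, c < phi v.
    by have := cphi (V w); move/cvgr_gt; apply.
  move=> /nbhs_ballP[e /= e0 He].
  (* Both [V w] and a point of the box lie within one radius of the rational centre, hence the
     factor 2. *)
  have [m me] : exists m : nat, 2 * m.+1%:R^-1 < e.
    exists (Num.bound (2 / e)); rewrite ltr_pdivrMr//.
    rewrite mulrC -ltr_pdivrMr// (@lt_le_trans _ _ (Num.bound (2 / e))%:R) ?ler_nat//.
    by rewrite archi_boundP// divr_ge0// ltW.
  have m0 : 0 < m.+1%:R^-1 :> R by rewrite invr_gt0.
  have /choice[q Hq] : forall j, exists q : rat, `|V w ord0 j - ratr q| < m.+1%:R^-1.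
    move=> j; have /rat_in_itvoo[q] : V w ord0 j - m.+1%:R^-1 < V w ord0 j.
      by rewrite ltrBlDr ltrDl.
    rewrite in_itv/= => /andP[q1 q2]; exists q.
    by rewrite gtr0_norm ?subr_gt0// ltrBlDr -ltrBlDl.
  have bq : box (\row_j q j, m) (V w) by move=> j; rewrite mxE.
  exists (\row_j q j, m) => //; rewrite /F asboolT// => v bv.
  apply: He; split => // i j; rewrite ord1 /ball/= (le_lt_trans _ me)//.
  rewrite -[X in `|X|](subrKA (ratr (q j))) (le_trans (ler_normD _ _))//.
  rewrite mulr2n mulrDl mul1r; apply: lerD; apply: ltW; first exact: Hq.
  by have := bv j; rewrite mxE distrC.
apply: countable_bigcupT_measurable; first exact: countableP.
move=> p; rewrite /F; case: asboolP => // _.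
rewrite (_ : mkset _ = \bigcap_(j in [set: 'I_n])
    [set w | `|V w ord0 j - ratr (p.1 ord0 j)| < p.2.+1%:R^-1]); last first.
  by apply/seteqP; split => w /= h j; [move=> _; exact: h|exact: h].
apply: fin_bigcap_measurable; first exact: finite_finset.
move=> j _; rewrite -[X in measurable X]setTI.
have : measurable_fun [set: T] (fun w => `|V w ord0 j - ratr (p.1 ord0 j)|).
  apply: measurableT_comp => //; apply: measurable_funB => //; exact: mV.
move=> /(_ measurableT `]-oo, (p.2.+1%:R^-1)[%classic (measurable_itv _)).
by congr measurable; apply/seteqP; split => w /=; rewrite in_itv.
Qed.

Lemma eucl_norm_random_vector {n} (V : T -> 'rV[R]_n) : random_vector V ->
  measurable_fun [set: T] (fun w => eucl_norm (V w)).
Proof.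
move=> mV; apply: (continuous_random_vector _ (@eucl_norm R n)) => //.
apply: (@eucl_lipschitz_continuous _ _ 1) => u v.
by rewrite mul1r ler_eucl_dist_dist.
Qed.

Lemma lipschitz_random_vector {n m} (V : T -> 'rV[R]_n) C
    (F : 'rV[R]_n -> 'rV[R]_m) : random_vector V ->
  (forall u v, eucl_norm (F u - F v) <= C * eucl_norm (u - v)) ->
  random_vector (fun w => F (V w)).
Proof.
move=> mV lip j; apply: (continuous_random_vector _ (fun u => F u ord0 j)) => //.
apply: (@eucl_lipschitz_continuous _ _ C) => u v.
apply: le_trans (lip u v); apply: le_trans (ler_coord_eucl_norm _ j).
by rewrite !mxE.
Qed.

Lemma random_vector_row_mx {n m} (V : T -> 'rV[R]_n) (W : T -> 'rV[R]_m) :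
  random_vector V -> random_vector W ->
  random_vector (fun w => row_mx (V w) (W w)).
Proof.
move=> mV mW j; case: (split_ordP j) => k ->.
- by under eq_fun do rewrite row_mxEl; exact: mV.
- by under eq_fun do rewrite row_mxEr; exact: mW.
Qed.

(** Stacking both vectors into one row reduces joint measurability to a single Lipschitz map on a
    space of dimension [n + m]. *)
Lemma lipschitz2_random_vector {n m p} (V : T -> 'rV[R]_n) (W : T -> 'rV[R]_m) C
    (F : 'rV[R]_n -> 'rV[R]_m -> 'rV[R]_p) : 0 <= C ->
  random_vector V -> random_vector W ->
  (forall u u' v v', eucl_norm (F u v - F u' v') <=
     C * (eucl_norm (u - u') + eucl_norm (v - v'))) ->
  random_vector (fun w => F (V w) (W w)).
Proof.
move=> C0 mV mW lip.
have Nl (u : 'rV[R]_(n + m)) : eucl_norm (lsubmx u) <= eucl_norm u.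
  rewrite -(@ler_pXn2r _ 2 isT) ?nnegrE// !eucl_norm_sqr /dot big_split_ord/=.
  rewrite (eq_bigr (fun i => u ord0 (lshift m i) * u ord0 (lshift m i))).
    by rewrite lerDl sumr_ge0// => i _; rewrite -expr2 sqr_ge0.
  by move=> i _; rewrite !mxE.
have Nr (u : 'rV[R]_(n + m)) : eucl_norm (rsubmx u) <= eucl_norm u.
  rewrite -(@ler_pXn2r _ 2 isT) ?nnegrE// !eucl_norm_sqr /dot big_split_ord/=.
  rewrite (eq_bigr (fun i => u ord0 (rshift n i) * u ord0 (rshift n i))).
    by rewrite lerDr sumr_ge0// => i _; rewrite -expr2 sqr_ge0.
  by move=> i _; rewrite !mxE.
rewrite (_ : (fun _ => _) = (fun w =>
    F (lsubmx (row_mx (V w) (W w))) (rsubmx (row_mx (V w) (W w))))); last first.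
  by apply/funext => w; rewrite row_mxKl row_mxKr.
apply: (@lipschitz_random_vector _ _ (fun w => row_mx (V w) (W w)) (2 * C)
  (fun u : 'rV[R]_(n + m) => F (lsubmx u) (rsubmx u))).
  exact: random_vector_row_mx.
move=> u v; rewrite (le_trans (lip _ _ _ _))// -!linearB/=.
rewrite -mulrA mulrCA ler_wpM2l// mulr2n mulrDl mul1r.
exact: lerD.
Qed.

Lemma random_vectorD {n} (V W : T -> 'rV[R]_n) :
  random_vector V -> random_vector W -> random_vector (fun w => V w + W w).
Proof.
move=> mV mW j; under eq_fun do rewrite mxE.
by apply: measurable_funD; [exact: mV|exact: mW].
Qed.

Lemma random_vectorZ {n} (k : R) (V : T -> 'rV[R]_n) :
  random_vector V -> random_vector (fun w => k *: V w).
Proof.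
move=> mV j; under eq_fun do rewrite mxE.
by apply: measurable_funM => //; exact: mV.
Qed.

Lemma random_vectorB {n} (V W : T -> 'rV[R]_n) :
  random_vector V -> random_vector W -> random_vector (fun w => V w - W w).
Proof.
move=> mV mW; apply: random_vectorD => // j; under eq_fun do rewrite mxE.
by apply: measurableT_comp => //; exact: mW.
Qed.

Lemma random_vector_cst {n} (v : 'rV[R]_n) : random_vector (fun _ : T => v).
Proof. by move=> j; exact: measurable_cst. Qed.

End random_vectors.

(** * Integrals of real random variables and orthogonality to the past *)

Section real_integrals.
Context {R : realType} {d : measure_display} {T : measurableType d}
  (P : probability T R).
Implicit Types (A : set T) (Y Z V M : T -> R).

Definition integrable_RV Y := P.-integrable [set: T] (EFin \o Y).

Lemma integrable_RV_sub A Y : measurable A -> integrable_RV Y ->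
  P.-integrable A (EFin \o Y).
Proof. by move=> mA; apply: integrableS. Qed.

Lemma integrable_RV_measurable Y : integrable_RV Y -> measurable_fun [set: T] Y.
Proof. by move/(@measurable_int _ _ _ P)/measurable_EFinP. Qed.

Lemma integrable_RV_cst (r : R) : integrable_RV (fun=> r).
Proof. exact: finite_measure_integrable_cst. Qed.

Lemma integrable_RVD Y Z : integrable_RV Y -> integrable_RV Z ->
  integrable_RV (fun w => Y w + Z w).
Proof. by move=> iY iZ; apply: (integrableD measurableT iY iZ). Qed.

Lemma integrable_RVZ (r : R) Y : integrable_RV Y ->
  integrable_RV (fun w => r * Y w).
Proof. by move=> iY; apply: (integrableZl measurableT r iY). Qed.

Lemma dominated_integrable_RV Y Z : measurable_fun [set: T] Y ->
  integrable_RV Z -> (forall w, `|Y w| <= Z w) -> integrable_RV Y.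
Proof.
move=> mY iZ YZ; apply: (le_integrable measurableT _ _ iZ).
  exact/measurable_EFinP.
by move=> w _ /=; rewrite lee_fin (le_trans (YZ w))// ler_norm.
Qed.

Lemma ge0_finite_integrable_RV Y (r : R) : measurable_fun [set: T] Y ->
  (forall w, 0 <= Y w) -> (\int[P]_w (Y w)%:E <= r%:E)%E -> integrable_RV Y.
Proof.
move=> mY Y0 Yr; apply/integrableP; split; first exact/measurable_EFinP.
under eq_integral do rewrite /= ger0_norm//.
exact: le_lt_trans Yr (ltry _).
Qed.

Lemma int_le A Y Z : measurable A -> integrable_RV Y -> integrable_RV Z ->
  (forall w, Y w <= Z w) -> \int[P]_(w in A) Y w <= \int[P]_(w in A) Z w.
Proof. by move=> mA iY iZ YZ; apply: le_Rintegral => //; exact: integrable_RV_sub. Qed.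

Lemma intD A Y Z : measurable A -> integrable_RV Y -> integrable_RV Z ->
  \int[P]_(w in A) (Y w + Z w) =
  \int[P]_(w in A) Y w + \int[P]_(w in A) Z w.
Proof. by move=> mA iY iZ; apply: RintegralD => //; exact: integrable_RV_sub. Qed.

Lemma intZ A (r : R) Y : measurable A -> integrable_RV Y ->
  \int[P]_(w in A) (r * Y w) = r * \int[P]_(w in A) Y w.
Proof. by move=> mA iY; apply: RintegralZl => //; exact: integrable_RV_sub. Qed.

Lemma int_le_setT A Y : measurable A -> integrable_RV Y -> (forall w, 0 <= Y w) ->
  \int[P]_(w in A) Y w <= \int[P]_w Y w.
Proof.
move=> mA iY Y0; rewrite Rintegral_mkcond; apply: le_Rintegral => //.
  rewrite -restrict_EFin; apply/integrable_restrict => //.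
  by rewrite setTI; exact: integrable_RV_sub.
by move=> w _; rewrite patchE; case: ifP.
Qed.

Lemma EFin_int A Y : measurable A -> integrable_RV Y ->
  (\int[P]_(w in A) Y w)%:E = (\int[P]_(w in A) (Y w)%:E)%E.
Proof.
by move=> mA iY; rewrite fineK//; apply: integrable_fin_num => //; exact: integrable_RV_sub.
Qed.

Lemma expectation_int Y : integrable_RV Y ->
  ('E_P[Y] = (\int[P]_w Y w)%R%:E)%E.
Proof. by move=> iY; rewrite EFin_int// unlock. Qed.

Import HBNNSimple.

Section orthogonality.
Variable (G : set_system T).
Hypothesis G_measurable : forall A, <<s G >> A -> measurable A.
Local Notation TG := (g_sigma_algebraType G).

Lemma sub_measurable_fun d' (U : measurableType d') (V : T -> U) :
  measurable_fun [set: TG] V -> measurable_fun [set: T] V.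
Proof. by move=> mV _ B mB; apply: G_measurable; exact: mV. Qed.

(** On each level set of [h] the integrand is a constant times [M], and the level set cuts [A] in an
    event of the sigma-algebra. *)
Lemma nnsfun_int_mean0 (h : {nnsfun TG >-> R}) M A :
  integrable_RV M -> (forall A, <<s G >> A -> (\int[P]_(w in A) (M w)%:E = 0)%E) ->
  <<s G >> A -> (\int[P]_(w in A) (h w * M w)%:E = 0)%E.
Proof.
move=> iM M0 GA; have mA := G_measurable _ GA.
have hB y : <<s G >> (h @^-1` [set y]) by exact: (measurable_sfunP h (measurable_set1 y)).
under eq_integral => w _.
  rewrite (fimfunE h) (fsbig_finite _ _ (fimfunP h))/= mulr_suml -sumEFin.
  over.
have E y : (fun w => (y * \1_(h @^-1` [set y]) w * M w)%:E) =
    (fun w => y%:E * ((EFin \o M) \_ (h @^-1` [set y])) w)%E.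
  apply/funext => w; rewrite -mulrA EFinM indicE patchE.
  by case: (w \in _); rewrite ?mul1r// mul0r mule0.
have iMB y : P.-integrable A ((EFin \o M) \_ (h @^-1` [set y])).
  apply: (@integrableS _ _ _ _ setT) => //.
  apply/integrable_restrict => //; first exact: G_measurable.
  by rewrite setTI; apply: integrable_RV_sub => //; exact: G_measurable.
rewrite integral_sum//; last first.
  by move=> y; rewrite E; apply: integrableZl.
apply: big1 => y _; rewrite E integralZl// -integral_mkcondr M0 ?mule0//.
exact: (@measurableI _ TG).
Qed.

(** Simple functions increase to [V], and [|V M|] dominates their products with [M]. *)
Lemma ge0_int_mul_mean0 V M A : measurable_fun [set: TG] V ->
  (forall w, 0 <= V w) ->
  integrable_RV M -> integrable_RV (fun w => V w * M w) ->
  (forall A, <<s G >> A -> (\int[P]_(w in A) (M w)%:E = 0)%E) ->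
  <<s G >> A -> (\int[P]_(w in A) (V w * M w)%:E = 0)%E.
Proof.
move=> mV V0 iM iVM M0 GA; have mA := G_measurable _ GA.
have mEV : measurable_fun [set: TG] (EFin \o V) by exact/measurable_EFinP.
pose h n : {nnsfun TG >-> R} := nnsfun_approx (@measurableT _ TG) mEV n.
have hV w : (fun n => (h n w)%:E) @ \oo --> (V w)%:E.
  by apply: cvg_nnsfun_approx => // t _ /=; rewrite lee_fin.
have hle n w : h n w <= V w.
  have nd : {homo (fun n => h n w) : n m / (n <= m)%N >-> n <= m}.
    by move=> a b ab; have /lefP := nd_nnsfun_approx (@measurableT _ TG) mEV ab; apply.
  have /fine_cvgP[_ hVw] := hV w.
  have <- : limn (fun n => h n w) = V w by apply/cvg_lim.
  by apply: (nondecreasing_cvgn_le nd); apply/cvg_ex; exists (V w).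
have mM := integrable_RV_measurable _ iM.
have [] := @dominated_convergence _ _ _ P A mA (fun n w => (h n w * M w)%:E)
  (fun w => (V w * M w)%:E) (fun w => (`|V w * M w|)%:E).
- move=> n; apply/measurable_EFinP; apply: measurable_funTS.
  by apply: measurable_funM => //; apply: sub_measurable_fun; exact: measurable_funP.
- apply/measurable_EFinP; apply: measurable_funTS.
  by apply: measurable_funM => //; exact: sub_measurable_fun.
- apply/aeW => w _; rewrite EFinM; under eq_fun do rewrite EFinM.
  by apply: cvgeZr => //; exact: hV.
- exact: (integrable_abse (integrable_RV_sub _ _ mA iVM)).
- apply/aeW => w n _; rewrite /= lee_fin !normrM ler_wpM2r//.
  by rewrite !ger0_norm// fun_ge0.
move=> _ _; under eq_fun do rewrite (nnsfun_int_mean0 _ _ _ iM M0 GA).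
by move=> /cvg_lim => <-//; rewrite lim_cst.
Qed.

Lemma int_mul_mean0 V M A : measurable_fun [set: TG] V ->
  integrable_RV M -> integrable_RV (fun w => V w * M w) ->
  (forall A, <<s G >> A -> (\int[P]_(w in A) (M w)%:E = 0)%E) ->
  <<s G >> A -> \int[P]_(w in A) (V w * M w) = 0.
Proof.
move=> mV iM iVM M0 GA; have mA := G_measurable _ GA.
have mM := integrable_RV_measurable _ iM.
pose Vp w := Num.max (V w) 0; pose Vn w := Num.max (- V w) 0.
have mVp : measurable_fun [set: TG] Vp by apply: measurable_funrpos.
have mVn : measurable_fun [set: TG] Vn by apply: measurable_funrneg.
have iabs : integrable_RV (fun w => `|V w * M w|) by exact: (integrable_abse iVM).
have part (U : T -> R) : measurable_fun [set: TG] U -> (forall w, 0 <= U w) ->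
    (forall w, U w <= `|V w|) ->
    integrable_RV (fun w => U w * M w) /\ \int[P]_(w in A) (U w * M w) = 0.
  move=> mU U0 UV; have iU : integrable_RV (fun w => U w * M w).
    apply: (dominated_integrable_RV _ _ _ iabs).
      by apply: measurable_funM => //; exact: sub_measurable_fun.
    by move=> w; rewrite !normrM ler_wpM2r// ger0_norm.
  by split => //; rewrite /Rintegral (ge0_int_mul_mean0 U M A).
have [ip p0] : integrable_RV (fun w => Vp w * M w) /\ \int[P]_(w in A) (Vp w * M w) = 0.
  by apply: part => // w; rewrite /Vp ?le_max ?lexx ?orbT// ge_max ler_norm normr_ge0.
have [i_n n0] : integrable_RV (fun w => Vn w * M w) /\ \int[P]_(w in A) (Vn w * M w) = 0.
  apply: part => // w; rewrite /Vn ?le_max ?lexx ?orbT// ge_max normr_ge0.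
  by rewrite -normrN ler_norm.
rewrite (_ : (fun w => V w * M w) = (fun w => Vp w * M w + (-1) * (Vn w * M w))).
  by rewrite intD// ?intZ// ?p0 ?n0 ?mulr0 ?addr0//; exact: integrable_RVZ.
apply/funext => w; rewrite mulN1r -mulrBl; congr (_ * _).
by rewrite /Vp /Vn; case: (leP (V w) 0) => V0; case: (leP (- V w) 0) => V1; lra.
Qed.

End orthogonality.
End real_integrals.

(** * Almost sure convergence of almost supermartingales *)

Section supermartingales.
Context {R : realType} {d : measure_display} {T : measurableType d}
  (P : probability T R).
Implicit Types (A B : set T) (Y Z : T -> R).

Lemma int_cst_prob A (r : R) : measurable A ->
  \int[P]_(_ in A) r = r * fine (P A).
Proof. by move=> mA; exact: Rintegral_cst. Qed.

Lemma prob_fineK A : measurable A -> (fine (P A))%:E = P A.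
Proof. by move=> mA; rewrite fineK// fin_num_measure. Qed.

Lemma fine_prob_le1 A : measurable A -> fine (P A) <= 1.
Proof. by move=> mA; rewrite -lee_fin prob_fineK// probability_le1. Qed.

Lemma int_setU A B Y : measurable A -> measurable B -> A `&` B = set0 ->
  integrable_RV P Y ->
  \int[P]_(w in A `|` B) Y w = \int[P]_(w in A) Y w + \int[P]_(w in B) Y w.
Proof.
move=> mA mB AB iY; apply: Rintegral_setU => //; last exact/disj_set2P.
by apply: integrable_RV_sub => //; exact: measurableU.
Qed.

Lemma markov_set B Y (r : R) : 0 <= r -> measurable B -> integrable_RV P Y ->
  (forall w, B w -> r <= Y w) -> r * fine (P B) <= \int[P]_(w in B) Y w.
Proof.
move=> r0 mB iY BY; rewrite -int_cst_prob//; apply: le_Rintegral => //.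
- by apply: integrable_RV_sub => //; exact: integrable_RV_cst.
- exact: integrable_RV_sub.
Qed.

Context (G : nat -> set_system T).
Hypotheses (G_measurable : forall k A, <<s G k >> A -> measurable A)
  (G_increasing : forall k, <<s G k >> `<=` <<s G k.+1 >>).
Context (W : nat -> T -> R) (tail : nat -> R).
Hypotheses (tail_ge0 : forall k, 0 <= tail k)
  (tail_cvg0 : tail k @[k --> \oo] --> (0 : R))
  (W_ge0 : forall k w, 0 <= W k w)
  (W_adapted : forall k,
     measurable_fun [set: g_sigma_algebraType (G k)] (W k))
  (W_integrable : forall k, integrable_RV P (W k))
  (W_supermartingale : forall k A, <<s G k >> A ->
     \int[P]_(w in A) W k.+1 w + tail k.+1 <= \int[P]_(w in A) W k w + tail k).

Let mlt k (r : R) : <<s G k >> [set w | W k w < r].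
Proof.
have := @W_adapted k measurableT `]-oo, r[%classic (measurable_itv _).
by rewrite setTI; congr (<<s _ >> _); apply/seteqP; split => w /=; rewrite in_itv.
Qed.

(** These events replace a stopping time: [W] is below [eta] at time [n] and below [lambda] from
    [n + 1] to [n + j]. A path stops at time [n + j + 1] when it is in [survival j] but not in
    [survival j.+1]. *)
Fixpoint survival n (eta lambda : R) j : set T :=
  if j is j'.+1 then survival n eta lambda j' `&` [set w | W (n + j) w < lambda]
  else [set w | W n w < eta].

Let survival_adapted n eta lambda j : <<s G (n + j) >> (survival n eta lambda j).
Proof.
elim: j => [|j IH]; first by rewrite addn0; exact: mlt.
apply: (@measurableI _ (g_sigma_algebraType (G (n + j.+1)))); last exact: mlt.
by rewrite addnS; exact: G_increasing.
Qed.

Let survival_decr n eta lambda j : survival n eta lambda j.+1 `<=` survival n eta lambda j.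
Proof. by move=> w []. Qed.

Let survival_decr0 n eta lambda j : survival n eta lambda j `<=` survival n eta lambda 0.
Proof. by elim: j => // j IH; apply: subset_trans IH; exact: survival_decr. Qed.

(* Doob's maximal inequality for the process started on [W n < eta] *)
Lemma almost_supermartingale_maximal n (eta lambda : R) j : 0 <= eta -> 0 <= lambda ->
  lambda * fine (P (survival n eta lambda 0 `\` survival n eta lambda j)) <=
  eta + tail n.
Proof.
move=> eta0 lambda0; pose S := survival n eta lambda.
have mS i : measurable (S i) by exact: G_measurable (survival_adapted n eta lambda i).
(* Invariant of the induction: the mass of [W] on surviving paths, [lambda] times the probability of
   having stopped, and the remaining tail. *)
suff : \int[P]_(w in S j) W (n + j)%N w + lambda * fine (P (S 0%N `\` S j))
    + tail (n + j) <= eta + tail n.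
  apply: le_trans; rewrite addrAC lerDr addr_ge0//; exact: Rintegral_ge0.
elim: j => [|j IH].
  rewrite setDv measure0 mulr0 addr0 addn0 lerD2r.
  apply: (@le_trans _ _ (\int[P]_(w in S 0%N) eta)).
    apply: le_Rintegral => //.
    - exact: integrable_RV_sub.
    - by apply: integrable_RV_sub => //; exact: integrable_RV_cst.
    - by move=> w /= /ltW.
  by rewrite int_cst_prob// ler_piMr// fine_prob_le1.
apply: le_trans IH.
have Sj : S j = S j.+1 `|` (S j `\` S j.+1).
  by rewrite setDUK//; exact: survival_decr.
have mD : measurable (S j `\` S j.+1) by exact: measurableD.
have h1 : \int[P]_(w in S j) W (n + j.+1)%N w + tail (n + j.+1) <=
    \int[P]_(w in S j) W (n + j)%N w + tail (n + j).
  by rewrite addnS; apply: W_supermartingale; exact: survival_adapted.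
have h2 : lambda * fine (P (S j `\` S j.+1)) <=
    \int[P]_(w in S j `\` S j.+1) W (n + j.+1)%N w.
  apply: markov_set => // w [Sjw]; rewrite /S/= => Sw.
  by rewrite leNgt; apply/negP => ?; exact: Sw.
have h3 : \int[P]_(w in S j) W (n + j.+1)%N w = \int[P]_(w in S j.+1) W (n + j.+1)%N w +
    \int[P]_(w in S j `\` S j.+1) W (n + j.+1)%N w.
  rewrite {1}Sj int_setU//.
  by apply/seteqP; split => // w [? []].
have h4 : P (S 0%N `\` S j.+1) = (P (S 0%N `\` S j) + P (S j `\` S j.+1))%E.
  rewrite -measureU//; last 2 first.
  - exact: measurableD.
  - by apply/seteqP; split => // w [[_ ?] []].
  congr (P _); apply/seteqP; split => w.
    move=> [S0 nSj1]; have [Sjw|nSj] := pselect (S j w); [by right|by left].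
  move=> [[S0 nSj]|[Sjw nSj1]]; split => //; first by move/survival_decr.
  exact: survival_decr0 Sjw.
have h5 : fine (P (S 0%N `\` S j.+1)) =
    fine (P (S 0%N `\` S j)) + fine (P (S j `\` S j.+1)).
  by rewrite h4 fineD// fin_num_measure//; exact: measurableD.
rewrite h5 mulrDr; lra.
Qed.

Lemma almost_supermartingale_cvg0 :
  (forall eta eps : R, 0 < eta -> 0 < eps ->
     \forall n \near \oo, fine (P [set w | eta <= W n w]) <= eps) ->
  {ae P, forall w, W n w @[n --> \oo] --> (0 : R)}.
Proof.
move=> cvgP.
have mle k (r : R) : measurable [set w | r <= W k w].
  rewrite (_ : mkset _ = ~` [set w | W k w < r]).
    exact: measurableC (G_measurable _ _ (mlt k r)).
  by apply/seteqP; split => w /=; rewrite leNgt => /negP.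
(* The event that [W] is at least [lambda] infinitely often. *)
pose N (lambda : R) := \bigcap_n \bigcup_(k in [set k | (n <= k)%N]) [set w | lambda <= W k w].
have mN lambda : measurable (N lambda).
  by apply: bigcapT_measurable => n; apply: bigcup_measurable.
have N0 (lambda : R) : 0 < lambda -> P.-negligible (N lambda).
  move=> lambda0; apply/negligibleP => //; apply/eqP; rewrite eq_le measure_ge0 andbT.
  apply/lee_addgt0Pr => eps eps0; rewrite add0e.
  (* Once [tail n < eta], the maximal inequality bounds the stopping probability by
     [2 * eta / lambda = eps / 2]. *)
  pose eta := lambda * (eps / 2) / 2.
  have eps20 : 0 < eps / 2 by rewrite divr_gt0.
  have eta0 : 0 < eta by rewrite divr_gt0// mulr_gt0.
  have [n [Hn tn]] : exists n, fine (P [set w | eta <= W n w]) <= eps / 2 /\ tail n < eta.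
    have tail_lt : \forall n \near \oo, tail n < eta.
      by move/cvgrPdist_lt : tail_cvg0 => /(_ _ eta0); apply: filterS => n;
        rewrite sub0r normrN ger0_norm.
    by have [n] := @filter_ex _ \oo _ _ (filterI (cvgP _ _ eta0 eps20) tail_lt); exists n.
  pose S := survival n eta lambda.
  have mS i : measurable (S i) by exact: G_measurable (survival_adapted n eta lambda i).
  have NS : N lambda `<=` [set w | eta <= W n w] `|` \bigcup_j (S 0%N `\` S j).
    move=> w Nw; have [|W0] := leP eta (W n w); first by left.
    (* [n.+1] and not [n]: the level [lambda] is tested only strictly after time [n], where the
       threshold is [eta]. *)
    right; have [k /= nk Wk] := Nw n.+1 I.
    have [i kE] : exists i, k = (n + i.+1)%N.
      by exists (k - n.+1)%N; rewrite addnS -addSn subnKC.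
    exists i.+1 => //; split => // -[_ /=].
    by rewrite -kE ltNge Wk.
  have mU : measurable (\bigcup_j (S 0%N `\` S j)).
    by apply: bigcup_measurable => j _; exact: measurableD.
  have PU : (P (\bigcup_j (S 0%N `\` S j)) <= (eps / 2)%:E)%E.
    have cP : P (S 0%N `\` S j) @[j --> \oo] --> P (\bigcup_j (S 0%N `\` S j)).
      apply: nondecreasing_cvg_mu => //; first by move=> j; exact: measurableD.
      move=> i j ij; apply/subsetPset; apply: setDS.
      rewrite -(subnKC ij); elim: (j - i)%N => [|l IH]; first by rewrite addn0.
      by rewrite addnS; apply: subset_trans IH; exact: survival_decr.
    rewrite -(cvg_lim _ cP)//; apply: lime_le; first by apply/cvg_ex; eexists; exact: cP.
    apply: nearW => j; rewrite -prob_fineK ?lee_fin; last exact: measurableD.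
    rewrite -(ler_pM2l lambda0).
    apply: (le_trans (almost_supermartingale_maximal n eta lambda j (ltW eta0) (ltW lambda0))).
    by rewrite [leRHS](_ : _ = eta + eta) ?lerD2l ?(ltW tn)// /eta -splitr.
  apply: (@le_trans _ _ (P ([set w | eta <= W n w] `|` \bigcup_j (S 0%N `\` S j)))).
    by apply: le_measure; rewrite ?inE//; exact: measurableU.
  apply: (le_trans (measureU2 _ (mle n eta) mU)).
  rewrite (_ : eps%:E = (eps / 2)%:E + (eps / 2)%:E)%E; last first.
    by rewrite -EFinD -splitr.
  by apply: leeD => //; move: Hn; rewrite -lee_fin prob_fineK.
have NB : P.-negligible (\bigcup_m N m.+1%:R^-1).
  by apply: negligible_bigcup => m; apply: N0; rewrite invr_gt0.
apply: negligibleS NB => w /= ncvg; apply: contrapT => nN; apply: ncvg.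
apply/cvgrPdist_lt => e e0.
have [m me] : exists m : nat, m.+1%:R^-1 < e.
  have ei : 0 <= e^-1 by rewrite invr_ge0 ltW.
  exists (Num.bound e^-1); rewrite invf_plt ?posrE//.
  by apply: lt_le_trans (archi_boundP ei) _; rewrite ler_nat.
have [n Hn] : exists n, forall k, (n <= k)%N -> W k w < m.+1%:R^-1.
  apply: contrapT => /forallNP H; apply: nN; exists m => // n _.
  have /existsNP[k /not_implyP[nk /negP]] := H n.
  by rewrite -leNgt => ?; exists k.
exists n => // k /= nk; rewrite sub0r normrN ger0_norm//.
exact: lt_trans (Hn k nk) me.
Qed.

End supermartingales.

(** * Square-integrable random vectors *)

Section square_integrable_vectors.
Context {R : realType} {d : measure_display} {T : measurableType d}
  (P : probability T R).

Definition square_integrable {n} (V : T -> 'rV[R]_n) : Prop :=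
  random_vector V /\ integrable_RV P (fun w => eucl_norm (V w) ^+ 2).

Lemma measurable_sqr_eucl_norm {n} (V : T -> 'rV[R]_n) : random_vector V ->
  measurable_fun [set: T] (fun w => eucl_norm (V w) ^+ 2).
Proof. by move=> mV; apply: measurable_funX; exact: eucl_norm_random_vector. Qed.

Lemma dominated_square_integrable {n} (V : T -> 'rV[R]_n) (Z : T -> R) :
  random_vector V -> integrable_RV P Z ->
  (forall w, eucl_norm (V w) ^+ 2 <= Z w) -> square_integrable V.
Proof.
move=> mV iZ VZ; split=> //; apply: (dominated_integrable_RV _ _ _ _ iZ).
  exact: measurable_sqr_eucl_norm.
by move=> w; rewrite ger0_norm ?sqr_ge0.
Qed.

Lemma square_integrable_cst {n} (v : 'rV[R]_n) : square_integrable (fun=> v).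
Proof. by split; [exact: random_vector_cst|exact: integrable_RV_cst]. Qed.

Lemma square_integrableD {n} (V W : T -> 'rV[R]_n) :
  square_integrable V -> square_integrable W ->
  square_integrable (fun w => V w + W w).
Proof.
move=> [mV iV] [mW iW].
apply: (dominated_square_integrable _ _ (random_vectorD _ _ mV mW)
  (integrable_RVD _ _ _ (integrable_RVZ _ 2 _ iV) (integrable_RVZ _ 2 _ iW))).
by move=> w; exact: sqr_eucl_normD_le2.
Qed.

Lemma square_integrableZ {n} (k : R) (V : T -> 'rV[R]_n) :
  square_integrable V -> square_integrable (fun w => k *: V w).
Proof.
move=> [mV iV]; apply: (dominated_square_integrable _ _ (random_vectorZ _ _ mV)
  (integrable_RVZ _ (k ^+ 2) _ iV)) => w.
by rewrite sqr_eucl_normZ.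
Qed.

Lemma square_integrableB {n} (V W : T -> 'rV[R]_n) :
  square_integrable V -> square_integrable W ->
  square_integrable (fun w => V w - W w).
Proof.
move=> sV sW; apply: square_integrableD => //.
by under eq_fun do rewrite -scaleN1r; exact: square_integrableZ.
Qed.

Lemma square_integrable_lipschitz {n m} (C : R) (F : 'rV[R]_n -> 'rV[R]_m)
    (V : T -> 'rV[R]_n) : 0 <= C ->
  (forall u v, eucl_norm (F u - F v) <= C * eucl_norm (u - v)) ->
  square_integrable V -> square_integrable (fun w => F (V w)).
Proof.
move=> C0 lip [mV iV].
apply: (dominated_square_integrable _ _ (lipschitz_random_vector _ _ _ mV lip)
  (integrable_RVD _ _ _ (integrable_RVZ _ (2 * C ^+ 2) _ iV)
    (integrable_RV_cst _ (2 * eucl_norm (F 0) ^+ 2)))) => w /=.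
rewrite -[F (V w)](subrK (F 0)) (le_trans (sqr_eucl_normD_le2 _ _))//.
rewrite lerD2r -mulrA ler_wpM2l// -exprMn ler_pXn2r// ?nnegrE ?mulr_ge0//.
by rewrite (le_trans (lip _ _))// subr0.
Qed.

Lemma square_integrable_lipschitz2 {n m p} (C : R)
    (F : 'rV[R]_n -> 'rV[R]_m -> 'rV[R]_p) (V : T -> 'rV[R]_n)
    (W : T -> 'rV[R]_m) : 0 <= C ->
  (forall u u' v v', eucl_norm (F u v - F u' v') <=
     C * (eucl_norm (u - u') + eucl_norm (v - v'))) ->
  square_integrable V -> square_integrable W ->
  square_integrable (fun w => F (V w) (W w)).
Proof.
move=> C0 lip [mV iV] [mW iW].
apply: (dominated_square_integrable _ _ (lipschitz2_random_vector _ _ _ _ C0 mV mW lip)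
  (integrable_RVD _ _ _ (integrable_RVD _ _ _ (integrable_RVZ _ (4 * C ^+ 2) _ iV)
    (integrable_RVZ _ (4 * C ^+ 2) _ iW))
    (integrable_RV_cst _ (2 * eucl_norm (F 0 0) ^+ 2)))) => w /=.
rewrite -[F (V w) (W w)](subrK (F 0 0)) (le_trans (sqr_eucl_normD_le2 _ _))//.
rewrite lerD2r (@le_trans _ _ (2 * (C * (eucl_norm (V w) + eucl_norm (W w))) ^+ 2))//.
  rewrite ler_wpM2l// ler_pXn2r// ?nnegrE ?mulr_ge0 ?addr_ge0//.
  by have := lip (V w) 0 (W w) 0; rewrite !subr0.
have := mulr_ge0 (sqr_ge0 C) (sqr_ge0 (eucl_norm (V w) - eucl_norm (W w))).
by move: (eucl_norm _) (eucl_norm _) => *; lra.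
Qed.

Lemma square_integrable_coord {n} (V : T -> 'rV[R]_n) (j : 'I_n) :
  square_integrable V -> integrable_RV P (fun w => V w ord0 j).
Proof.
move=> [mV iV]; apply: (dominated_integrable_RV _ _ _ (mV j)
  (integrable_RVD _ _ _ (integrable_RV_cst _ 1) iV)) => w.
have := ler_coord_eucl_norm (V w) j; have := sqr_ge0 (eucl_norm (V w) - 1).
rewrite sqrrB1 => h1 h2; apply: (le_trans h2).
by have := eucl_norm_ge0 (V w); move: h1; clear h2; move: (eucl_norm _) => *; lra.
Qed.

Section martingale_difference.
Variable G : set_system T.
Hypothesis G_measurable : forall A, <<s G >> A -> measurable A.

Lemma sub_random_vector {n} (V : T -> 'rV[R]_n) :
  random_vector (T := g_sigma_algebraType G) V -> random_vector V.
Proof. by move=> mV j; apply: (sub_measurable_fun G); [|exact: mV]. Qed.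

(** Coordinate by coordinate: each product is dominated by [|V|^2 + |M|^2], hence integrable. *)
Lemma int_dot_mean0 {n} (V M : T -> 'rV[R]_n) :
  random_vector (T := g_sigma_algebraType G) V ->
  square_integrable V -> square_integrable M ->
  (forall j A, <<s G >> A -> (\int[P]_(w in A) (M w ord0 j)%:E = 0)%E) ->
  integrable_RV P (fun w => dot (V w) (M w)) /\
  forall A, <<s G >> A -> \int[P]_(w in A) dot (V w) (M w) = 0.
Proof.
move=> mV sV sM M0; have [rV iV] := sV; have [rM iM] := sM.
have iVM j : integrable_RV P (fun w => V w ord0 j * M w ord0 j).
  apply: (dominated_integrable_RV _ _ _ _ (integrable_RVD _ _ _ iV iM)).
    by apply: measurable_funM; [exact: rV|exact: rM].
  move=> w; have := ler_coord_eucl_norm (V w) j; have := ler_coord_eucl_norm (M w) j.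
  move=> h1 h2; rewrite normrM (le_trans (ler_pM _ _ h2 h1))//.
  have := sqr_ge0 (eucl_norm (V w) - eucl_norm (M w)).
  have := sqr_ge0 (eucl_norm (V w)); have := sqr_ge0 (eucl_norm (M w)).
  by clear h1 h2; move: (eucl_norm _) (eucl_norm _) => *; lra.
have dotE0 : (EFin \o (fun w => dot (V w) (M w))) =
    (fun w => (\sum_(j < n) (V w ord0 j * M w ord0 j)%:E)%E).
  by apply/funext => w; rewrite /= sumEFin.
split.
  by rewrite /integrable_RV dotE0; apply: integrable_sum => // j _; exact: iVM.
move=> A GA; have mA := G_measurable _ GA.
rewrite /Rintegral -[X in fine X]/(\int[P]_(w in A) ((EFin \o (fun w => dot (V w) (M w))) w))%E.
rewrite dotE0 integral_sum//; last by move=> j; apply: (integrable_RV_sub _ _ _ mA (iVM j)).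
rewrite big1//= => j _; rewrite -EFin_int//.
by rewrite (int_mul_mean0 _ G G_measurable _ _ _ (mV j) (square_integrable_coord _ _ sM)
  (iVM j) (M0 j)).
Qed.

End martingale_difference.
End square_integrable_vectors.

(** * The stochastic iteration *)

Section two_time_scale_iteration.
Context {R : realType} {d1 d2 : nat} (X : set 'rV[R]_d1)
  (f : 'rV[R]_d1 -> 'rV[R]_d2 -> 'rV[R]_d1)
  (g : 'rV[R]_d1 -> 'rV[R]_d2 -> 'rV[R]_d2) (mu L c1 c2 alpha beta a b K1 : R)
  {disp : measure_display} {T : measurableType disp} (P : probability T R)
  (x0 : 'rV[R]_d1) (y0 : 'rV[R]_d2)
  (M : nat -> T -> 'rV[R]_d1) (M' : nat -> T -> 'rV[R]_d2)
  (x : nat -> T -> 'rV[R]_d1) (y : nat -> T -> 'rV[R]_d2).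
Local Notation s := (step_size alpha a K1).
Local Notation t := (step_size beta b K1).
Hypotheses (X_nonempty : X !=set0) (X_closed : closed X)
  (X_convex : @convex_set R 'rV[R]_d1 X)
  (X_bounded : exists B : R, forall u, X u -> eucl_norm u <= B)
  (mu_bounds : 0 <= mu < 1)
  (f_contraction : forall x1 x2 y',
     eucl_norm (f x1 y' - f x2 y') <= mu * eucl_norm (x1 - x2))
  (g_nonexpansive : forall y1 y2,
     eucl_norm (g (xhat X f y1) y1 - g (xhat X f y2) y2)
       <= eucl_norm (y1 - y2))
  (Yhat_nonempty : Yhat X f g !=set0)
  (L_gt0 : 0 < L) (c1_gt0 : 0 < c1)
  (fg_lipschitz : forall x1 x2 y1 y2,
     eucl_norm (f x1 y1 - f x2 y2) + eucl_norm (g x1 y1 - g x2 y2)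
       <= L * (eucl_norm (x1 - x2) + eucl_norm (y1 - y2)))
  (fg_growth : forall x' y',
     eucl_norm (f x' y') + eucl_norm (g x' y')
       <= c1 * (1 + eucl_norm x' + eucl_norm y'))
  (M_random : forall k, random_vector (M k.+1))
  (M'_random : forall k, random_vector (M' k.+1))
  (M_mean0 : forall k (j : 'I_d1),
     is_cond_expectation P (noise_filtration x0 y0 M M' k)
       (fun w => (M k.+1 w ord0 j)%:E) (fun=> 0%E))
  (M'_mean0 : forall k (j : 'I_d2),
     is_cond_expectation P (noise_filtration x0 y0 M M' k)
       (fun w => (M' k.+1 w ord0 j)%:E) (fun=> 0%E))
  (c2_gt0 : 0 < c2)
  (noise_variance : forall k, exists Z : T -> \bar R,
     is_cond_expectation P (noise_filtration x0 y0 M M' k)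
       (fun w => (eucl_norm (M k.+1 w) ^+ 2 + eucl_norm (M' k.+1 w) ^+ 2)%:E) Z
     /\ {ae P, forall w,
          (Z w <= (c2 * (1 + eucl_norm (x k w) ^+ 2
                           + eucl_norm (y k w) ^+ 2))%:E)%E})
  (a_gt : 2^-1 < a) (a_lt_b : a < b) (b_lt1 : b < 1)
  (alpha_bounds : 0 < alpha <= 2^-1) (beta_bounds : 0 < beta <= 2^-1)
  (K1_ge1 : 1 <= K1)
  (step_ratio : forall k, t k ^+ 2 / s k ^+ 3 <= 1)
  (K1_ge : gamma2 mu alpha beta a b <= K1)
  (x_init : forall w, x 0%N w = x0)
  (y_init : forall w, y 0%N w = y0)
  (x_step : forall k w,
     x k.+1 w = eucl_proj X (x k w + s k *:
                          (f (x k w) (y k w) - x k w + M k.+1 w)))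
  (y_step : forall k w,
     y k.+1 w = y k w + t k *:
                  (g (x k w) (y k w) - y k w + M' k.+1 w)).

(** The generators of [noise_filtration] without the closure, as [g_sigma_algebraType] takes a
    generating family. *)
Definition noise_events k : set_system T :=
  vector_events (fun=> x0) `|` vector_events (fun=> y0) `|`
    \bigcup_(i in [set i | (0 < i <= k)%N])
      (vector_events (M i) `|` vector_events (M' i)).

Local Notation TF k := (g_sigma_algebraType (noise_events k)).

Let vector_events_measurable n (V : T -> 'rV[R]_n) : random_vector V ->
  vector_events V `<=` measurable.
Proof. by move=> mV _ [j _ [B mB <-]]; exact: mV. Qed.

Lemma noise_filtration_measurable k A : <<s noise_events k >> A -> measurable A.
Proof.
apply: smallest_sub; first exact: sigma_algebra_measurable.
move=> B [[]|[i /= /andP[i0 _]] []].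
- exact: (vector_events_measurable _ _ (random_vector_cst _)).
- exact: (vector_events_measurable _ _ (random_vector_cst _)).
- by case: i i0 => // i _; exact: (vector_events_measurable _ _ (M_random i)).
- by case: i i0 => // i _; exact: (vector_events_measurable _ _ (M'_random i)).
Qed.

Lemma noise_filtration_increasing k :
  <<s noise_events k >> `<=` <<s noise_events k.+1 >>.
Proof.
apply: sub_sigma_algebra2; apply: setUS; apply: bigcup_subset => i /= /andP[-> ik].
by rewrite ltnW.
Qed.

Let random_vectorS k n (V : T -> 'rV[R]_n) :
  random_vector (T := TF k) V -> random_vector (T := TF k.+1) V.
Proof.
by move=> mV j _ B mB; apply: noise_filtration_increasing; exact: mV.
Qed.

Let vector_events_random k n (V : T -> 'rV[R]_n) :
  vector_events V `<=` noise_events k -> random_vector (T := TF k) V.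
Proof.
move=> VF j _ B mB; apply: sub_sigma_algebra; apply: VF.
by exists j => //; exists B.
Qed.

Let M_adapted k : random_vector (T := TF k.+1) (M k.+1).
Proof.
by apply: vector_events_random => B MB; right; exists k.+1 => /=; [rewrite leqnn|left].
Qed.

Let M'_adapted k : random_vector (T := TF k.+1) (M' k.+1).
Proof.
by apply: vector_events_random => B MB; right; exists k.+1 => /=; [rewrite leqnn|right].
Qed.

Let L_ge0 : 0 <= L. Proof. exact: ltW. Qed.
Let alpha_gt0 : 0 < alpha. Proof. by case/andP: alpha_bounds. Qed.
Let beta_gt0 : 0 < beta. Proof. by case/andP: beta_bounds. Qed.
Let a_gt0 : 0 < a. Proof. by apply: lt_trans a_gt; rewrite invr_gt0. Qed.
Let b_gt0 : 0 < b. Proof. exact: lt_trans a_gt0 a_lt_b. Qed.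
Let s_gt0 k : 0 < s k. Proof. exact: step_gt0. Qed.
Let t_gt0 k : 0 < t k. Proof. exact: step_gt0. Qed.
Let s_le1 k : s k <= 1.
Proof.
apply: (le_trans (step_le _ _ _ alpha_gt0 a_gt0 K1_ge1 k)).
by case/andP: alpha_bounds => _ /le_trans; apply; rewrite invf_le1// ler1n.
Qed.
Let t_le2 k : t k <= 2^-1.
Proof.
apply: (le_trans (step_le _ _ _ beta_gt0 b_gt0 K1_ge1 k)).
by case/andP: beta_bounds.
Qed.
Let ts k : t k ^+ 2 <= s k ^+ 3.
Proof. by rewrite -[leRHS]mul1r -ler_pdivrMr// exprn_gt0. Qed.
Let ts2 k : t k ^+ 2 <= s k ^+ 2.
Proof. by apply: (le_trans (ts k)); rewrite exprSr ler_piMr// sqr_ge0. Qed.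
Let t_le_s k : t k <= s k.
Proof. by rewrite -(@ler_pXn2r _ 2)// nnegrE ltW. Qed.

Let f_lip := f_lipschitz f g L fg_lipschitz.
Let g_lip := g_lipschitz f g L fg_lipschitz.
Let proj_lip u v : eucl_norm (eucl_proj X u - eucl_proj X v) <= 1 * eucl_norm (u - v).
Proof. by rewrite mul1r; exact: eucl_proj_nonexpansive. Qed.
Let xhat_lip := xhat_lipschitz X f g mu L X_nonempty X_closed X_convex X_bounded
  mu_bounds f_contraction fg_lipschitz.

Lemma iterates_adapted k :
  random_vector (T := TF k) (x k) /\ random_vector (T := TF k) (y k).
Proof.
elim: k => [|k [mx my]].
  rewrite (_ : x 0%N = fun=> x0); last exact/funext.
  rewrite (_ : y 0%N = fun=> y0); last exact/funext.
  by split; exact: random_vector_cst.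
have {}mx := random_vectorS _ _ _ mx; have {}my := random_vectorS _ _ _ my.
split.
- rewrite (_ : x k.+1 = fun w => eucl_proj X (x k w + s k *:
    (f (x k w) (y k w) - x k w + M k.+1 w))); last by apply/funext => w.
  apply: (lipschitz_random_vector (T := TF k.+1) (fun w => x k w + s k *:
    (f (x k w) (y k w) - x k w + M k.+1 w)) 1 (eucl_proj X)); last exact: proj_lip.
  apply: (random_vectorD (T := TF k.+1)) => //; apply: (random_vectorZ (T := TF k.+1)).
  apply: (random_vectorD (T := TF k.+1)) => //; apply: (random_vectorB (T := TF k.+1)) => //.
  exact: (lipschitz2_random_vector (T := TF k.+1) _ _ L).
- rewrite (_ : y k.+1 = fun w => y k w + t k *:
    (g (x k w) (y k w) - y k w + M' k.+1 w)); last by apply/funext => w.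
  apply: (random_vectorD (T := TF k.+1)) => //; apply: (random_vectorZ (T := TF k.+1)).
  apply: (random_vectorD (T := TF k.+1)) => //; apply: (random_vectorB (T := TF k.+1)) => //.
  exact: (lipschitz2_random_vector (T := TF k.+1) _ _ L).
Qed.

Lemma x_bounded : exists B, forall k w, eucl_norm (x k w) <= B.
Proof.
(* [x0] need not lie in [X]; every later iterate does. *)
have [B XB] := X_bounded; exists (Num.max B (eucl_norm x0)) => -[|k] w.
  by rewrite x_init le_max lexx orbT.
rewrite x_step le_max XB//.
by case: (eucl_projP X_nonempty X_closed (x k w + s k *: (f (x k w) (y k w) - x k w + M k.+1 w))).
Qed.

(** A random variable, not its mean: the factor of [c2] in the bound on the conditional variance. *)
Definition second_moment k w : R := 1 + eucl_norm (x k w) ^+ 2 + eucl_norm (y k w) ^+ 2.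

Lemma second_moment_ge0 k w : 0 <= second_moment k w.
Proof. by rewrite /second_moment !addr_ge0 ?sqr_ge0. Qed.

Let x_random k : random_vector (x k).
Proof.
exact: (sub_random_vector _ (noise_filtration_measurable k) _ (iterates_adapted k).1).
Qed.

Let y_random k : random_vector (y k).
Proof.
exact: (sub_random_vector _ (noise_filtration_measurable k) _ (iterates_adapted k).2).
Qed.

Lemma x_square_integrable k : square_integrable P (x k).
Proof.
have [B xB] := x_bounded.
apply: (dominated_square_integrable _ _ _ (x_random k) (integrable_RV_cst _ (B ^+ 2))) => w.
by rewrite ler_pXn2r// ?nnegrE// (le_trans _ (xB k w)).
Qed.

(** * Variance of the noise and its orthogonality to the past *)

Section noise.
Variable k : nat.
Hypothesis y_sq : square_integrable P (y k).

Lemma second_moment_integrable : integrable_RV P (second_moment k).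
Proof.
apply: integrable_RVD; last by case: y_sq.
apply: integrable_RVD; first exact: integrable_RV_cst.
by case: (x_square_integrable k).
Qed.

Let noise_sqr w := eucl_norm (M k.+1 w) ^+ 2 + eucl_norm (M' k.+1 w) ^+ 2.

Let noise_sqr_measurable : measurable_fun [set: T] noise_sqr.
Proof.
by apply: measurable_funD; apply: measurable_sqr_eucl_norm; [exact: M_random|exact: M'_random].
Qed.

Let noise_sqr_le A : <<s noise_events k >> A ->
  (\int[P]_(w in A) (noise_sqr w)%:E <=
   \int[P]_(w in A) (c2 * second_moment k w)%:E)%E.
Proof.
move=> FA; have mA := noise_filtration_measurable _ _ FA.
have [Z [[_ hZ _ ZE] Zle]] := noise_variance k; rewrite -ZE//.
have mZ : measurable_fun [set: T] Z.
  by case: hZ => [/(@measurable_int _ _ _ P)//|[]].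
(* The version [Z] is integrable or nonnegative; bounding by its positive part treats both cases at
   once and suits an upper bound holding only almost everywhere. *)
rewrite integralE.
apply: (@le_trans _ _ (\int[P]_(w in A) Z^\+ w)%E).
  by rewrite geeDl// oppe_le0; exact: integral_ge0.
apply: ae_ge0_le_integral => //.
- apply: measurable_funTS; exact: measurable_funepos.
- by move=> w _; rewrite lee_fin mulr_ge0 ?second_moment_ge0// ltW.
- apply/measurable_EFinP; apply: measurable_funTS.
  apply: integrable_RV_measurable; apply: integrable_RVZ; exact: second_moment_integrable.
- apply: filterS Zle => w Zw _; rewrite funeposE ge_max Zw/=.
  by rewrite lee_fin mulr_ge0 ?second_moment_ge0// ltW.
Qed.

Let noise_sqr_integrable : integrable_RV P noise_sqr.
Proof.
have i2 := integrable_RVZ _ c2 _ second_moment_integrable.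
apply: (ge0_finite_integrable_RV _ _ (\int[P]_w (c2 * second_moment k w))) => //.
  by move=> w; rewrite addr_ge0 ?sqr_ge0.
rewrite EFin_int//; apply: noise_sqr_le.
exact: (@measurableT _ (TF k)).
Qed.

Lemma M_square_integrable : square_integrable P (M k.+1).
Proof.
apply: (dominated_square_integrable _ _ _ (M_random k) noise_sqr_integrable) => w.
by rewrite lerDl sqr_ge0.
Qed.

Lemma M'_square_integrable : square_integrable P (M' k.+1).
Proof.
apply: (dominated_square_integrable _ _ _ (M'_random k) noise_sqr_integrable) => w.
by rewrite lerDr sqr_ge0.
Qed.

Lemma int_noise_sqr A : <<s noise_events k >> A ->
  \int[P]_(w in A) (eucl_norm (M k.+1 w) ^+ 2) +
  \int[P]_(w in A) (eucl_norm (M' k.+1 w) ^+ 2) <=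
  c2 * \int[P]_(w in A) second_moment k w.
Proof.
move=> FA; have mA := noise_filtration_measurable _ _ FA.
have [_ iM] := M_square_integrable; have [_ iM'] := M'_square_integrable.
rewrite -intD// -intZ//; last exact: second_moment_integrable.
rewrite -lee_fin !EFin_int//; first exact: noise_sqr_le.
by apply: integrable_RVZ; exact: second_moment_integrable.
Qed.

Lemma int_dot_M V A : random_vector (T := TF k) V -> square_integrable P V ->
  <<s noise_events k >> A ->
  integrable_RV P (fun w => dot (V w) (M k.+1 w)) /\
  \int[P]_(w in A) dot (V w) (M k.+1 w) = 0.
Proof.
move=> mV sV FA.
have [] := int_dot_mean0 P (noise_events k) (noise_filtration_measurable k) V (M k.+1)
  mV sV M_square_integrable.
  move=> j B FB; have [_ _ _ <-//] := M_mean0 k j.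
  by rewrite integral0.
by move=> iVM /(_ _ FA).
Qed.

Lemma int_dot_M' V A : random_vector (T := TF k) V -> square_integrable P V ->
  <<s noise_events k >> A ->
  integrable_RV P (fun w => dot (V w) (M' k.+1 w)) /\
  \int[P]_(w in A) dot (V w) (M' k.+1 w) = 0.
Proof.
move=> mV sV FA.
have [] := int_dot_mean0 P (noise_events k) (noise_filtration_measurable k) V (M' k.+1)
  mV sV M'_square_integrable.
  move=> j B FB; have [_ _ _ <-//] := M'_mean0 k j.
  by rewrite integral0.
by move=> iVM /(_ _ FA).
Qed.

End noise.

(** The induction alternates with the noise: square integrability of [y k] gives that of [M' k.+1],
    which gives that of [y k.+1]. Hence the hypothesis [y_sq] above. *)
Lemma y_square_integrable k : square_integrable P (y k).
Proof.
elim: k => [|k IH].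
  rewrite (_ : y 0%N = fun=> y0); last exact/funext.
  exact: square_integrable_cst.
rewrite (_ : y k.+1 = fun w => y k w + t k *:
  (g (x k w) (y k w) - y k w + M' k.+1 w)); last by apply/funext => w.
apply: square_integrableD => //; apply: square_integrableZ.
apply: square_integrableD; last exact: M'_square_integrable.
apply: square_integrableB => //.
apply: (square_integrable_lipschitz2 _ L) => //; exact: x_square_integrable.
Qed.

(** The vectors whose inner product with the noise of index [k.+1] integrates to 0 over every event
    of the past. *)
Definition adapted_square_integrable k n (V : T -> 'rV[R]_n) :=
  random_vector (T := TF k) V /\ square_integrable P V.
Local Notation asi := adapted_square_integrable.

Let asi_x k : asi k _ (x k).
Proof. by split; [case: (iterates_adapted k)|exact: x_square_integrable]. Qed.

Let asi_y k : asi k _ (y k).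
Proof. by split; [case: (iterates_adapted k)|exact: y_square_integrable]. Qed.

Let asiD k n (V W : T -> 'rV[R]_n) : asi k _ V -> asi k _ W ->
  asi k _ (fun w => V w + W w).
Proof.
by move=> [aV sV] [aW sW]; split;
  [exact: (random_vectorD (T := TF k))|exact: square_integrableD].
Qed.

Let asiB k n (V W : T -> 'rV[R]_n) : asi k _ V -> asi k _ W ->
  asi k _ (fun w => V w - W w).
Proof.
by move=> [aV sV] [aW sW]; split;
  [exact: (random_vectorB (T := TF k))|exact: square_integrableB].
Qed.

Let asiZ k n (r : R) (V : T -> 'rV[R]_n) : asi k _ V ->
  asi k _ (fun w => r *: V w).
Proof.
by move=> [aV sV]; split;
  [exact: (random_vectorZ (T := TF k))|exact: square_integrableZ].
Qed.

Let asi_cst k n (v : 'rV[R]_n) : asi k _ (fun=> v).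
Proof.
by split; [exact: (random_vector_cst (T := TF k))|exact: square_integrable_cst].
Qed.

Let asi_lip k n m (C : R) (F : 'rV[R]_n -> 'rV[R]_m) V : 0 <= C ->
  (forall u v, eucl_norm (F u - F v) <= C * eucl_norm (u - v)) ->
  asi k _ V -> asi k _ (fun w => F (V w)).
Proof.
move=> C0 lip [aV sV]; split; last exact: square_integrable_lipschitz C0 lip sV.
exact: (lipschitz_random_vector (T := TF k) _ _ _ aV lip).
Qed.

Let asi_lip2 k n m p (F : 'rV[R]_n -> 'rV[R]_m -> 'rV[R]_p) V W :
  (forall u u' v v', eucl_norm (F u v - F u' v') <=
     L * (eucl_norm (u - u') + eucl_norm (v - v'))) ->
  asi k _ V -> asi k _ W -> asi k _ (fun w => F (V w) (W w)).
Proof.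
move=> lip [aV sV] [aW sW]; split.
  exact: (lipschitz2_random_vector (T := TF k) _ _ _ _ L_ge0 aV aW lip).
exact: square_integrable_lipschitz2 L_ge0 lip sV sW.
Qed.

Let sqr_int k n (V : T -> 'rV[R]_n) : asi k _ V ->
  integrable_RV P (fun w => eucl_norm (V w) ^+ 2).
Proof. by case=> _ []. Qed.

Let sqr_adapted k n (V : T -> 'rV[R]_n) : asi k _ V ->
  measurable_fun [set: TF k] (fun w => eucl_norm (V w) ^+ 2).
Proof. by case=> aV _; exact: (measurable_sqr_eucl_norm (T := TF k)). Qed.

Let h z := g (xhat X f z) z.

Let h_lip u v : eucl_norm (h u - h v) <= 1 * eucl_norm (u - v).
Proof. by rewrite mul1r; exact: g_nonexpansive. Qed.

Let mu_lt1 : 0 < 1 - mu. Proof. by case/andP: mu_bounds => _; rewrite subr_gt0. Qed.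

Let asi_xhat k V : asi k _ V -> asi k _ (fun w => xhat X f (V w)).
Proof. by apply: asi_lip xhat_lip; rewrite divr_ge0// ltW. Qed.

Let asi_h k V : asi k _ V -> asi k _ (fun w => h (V w)).
Proof. exact: asi_lip ler01 h_lip. Qed.

(** * Integrated one-step inequalities and boundedness of moments *)

Definition tracking_error k w : R := eucl_norm (x k w - xhat X f (y k w)) ^+ 2.
Local Notation e := tracking_error.

Definition residual k w : R :=
  eucl_norm (g (xhat X f (y k w)) (y k w) - y k w) ^+ 2.

Let asi_e k : asi k _ (fun w => x k w - xhat X f (y k w)).
Proof. by apply: asiB => //; exact: asi_xhat. Qed.

Let asi_r k : asi k _ (fun w => h (y k w) - y k w).
Proof. by apply: asiB => //; exact: asi_h. Qed.

Let e_int k : integrable_RV P (e k). Proof. exact: sqr_int (asi_e k). Qed.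
Let r_int k : integrable_RV P (residual k). Proof. exact: sqr_int (asi_r k). Qed.
Let q_int k : integrable_RV P (second_moment k).
Proof. by apply: second_moment_integrable; case: (asi_y k). Qed.
Let M_int k : integrable_RV P (fun w => eucl_norm (M k.+1 w) ^+ 2).
Proof. by case: (M_square_integrable k (asi_y k).2). Qed.
Let M'_int k : integrable_RV P (fun w => eucl_norm (M' k.+1 w) ^+ 2).
Proof. by case: (M'_square_integrable k (asi_y k).2). Qed.

Let int_M'_le k A : <<s noise_events k >> A ->
  \int[P]_(w in A) (eucl_norm (M' k.+1 w) ^+ 2) <=
  c2 * \int[P]_(w in A) second_moment k w.
Proof.
move=> FA; apply: le_trans (int_noise_sqr k (asi_y k).2 A FA).
by rewrite lerDr; apply: Rintegral_ge0 => w _; rewrite sqr_ge0.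
Qed.

(** The integrated form of a conditional inequality: on events [A] of the past, the inner product of
    [fast_direction] with the noise integrates to 0. *)
Lemma int_tracking_error_step : exists2 C, 0 <= C &
  forall k A, <<s noise_events k >> A ->
  \int[P]_(w in A) e k.+1 w <= (1 - (1 - mu) * s k) * \int[P]_(w in A) e k w
    + C * s k ^+ 2 * \int[P]_(w in A) second_moment k w.
Proof.
have [C C0 HC] := fast_step X f g mu L c1 X_nonempty X_closed X_convex X_bounded
  mu_bounds f_contraction L_gt0 c1_gt0 fg_lipschitz fg_growth.
exists (C * (1 + c2)) => [|k A FA]; first by rewrite mulr_ge0 ?addr_ge0// ltW.
have mA := noise_filtration_measurable _ _ FA.
pose u w := fast_direction X f (s k) (x k w) (y k w).
have asi_u : asi k _ u.
  apply: asiD; apply: asiZ; first exact: asi_e.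
  by apply: asiB; apply: (asi_lip2 _ _ _ _ f) => //; exact: asi_xhat.
have [iu u0] := int_dot_M k (asi_y k).2 u A asi_u.1 asi_u.2 FA.
pose r := 2 * s k * (1 + (1 - mu) * s k).
have i1 := integrable_RVZ P (1 - (1 - mu) * s k) _ (e_int k).
have i2 := integrable_RVZ P r _ iu.
have i12 := integrable_RVD P _ _ i1 i2.
have i3 := integrable_RVD P _ _ (q_int k) (M_int k).
have i4 := integrable_RVD P _ _ i3 (M'_int k).
have i5 := integrable_RVZ P (C * s k ^+ 2) _ i4.
apply: (le_trans (int_le P A _ _ mA (e_int k.+1) (integrable_RVD P _ _ i12 i5) _)).
  move=> w; rewrite /e x_step y_step; apply: HC => //.
  by rewrite s_gt0 s_le1.
rewrite (intD P A _ _ mA i12 i5) (intD P A _ _ mA i1 i2) (intZ P A _ _ mA (e_int k)).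
rewrite (intZ P A _ _ mA iu) u0 mulr0 addr0 lerD2l.
rewrite (intZ P A _ _ mA i4) (intD P A _ _ mA i3 (M'_int k)) (intD P A _ _ mA (q_int k) (M_int k)).
have := ler_wpM2l (mulr_ge0 (ltW C0) (sqr_ge0 (s k))) (int_noise_sqr k (asi_y k).2 A FA).
rewrite (_ : C * (1 + c2) * s k ^+ 2 = C * s k ^+ 2 * (1 + c2)); last by ring.
move: (C * s k ^+ 2) (\int[P]_(w in A) second_moment k w).
move: (\int[P]_(w in A) (eucl_norm (M k.+1 w) ^+ 2)).
by move: (\int[P]_(w in A) (eucl_norm (M' k.+1 w) ^+ 2)) => *; lra.
Qed.

(** The comparison point may depend on the past: a constant serves the moment bounds, the projection
    of [y k] the almost sure part. The noise factor [t k ^+ 2] is relaxed to [s k ^+ 2] like the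
    other errors. *)
Lemma int_slow_error_step k A p : <<s noise_events k >> A -> asi k _ p ->
  (forall w, Yhat X f g (p w)) ->
  \int[P]_(w in A) (eucl_norm (y k.+1 w - p w) ^+ 2) <=
  (1 + s k ^+ 2) * \int[P]_(w in A) (eucl_norm (y k w - p w) ^+ 2)
  - t k / 2 * \int[P]_(w in A) residual k w
  + 2 * L ^+ 2 * s k * \int[P]_(w in A) e k w
  + c2 * s k ^+ 2 * \int[P]_(w in A) second_moment k w.
Proof.
move=> FA asi_p Yp; have mA := noise_filtration_measurable _ _ FA.
pose u w := slow_direction g (t k) (p w) (x k w) (y k w).
have asi_yp : asi k _ (fun w => y k w - p w) by exact: asiB.
have asi_u : asi k _ u.
  apply: asiD => //; apply: asiZ; apply: asiB => //.
  exact: (asi_lip2 _ _ _ _ g).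
have [iu u0] := int_dot_M' k (asi_y k).2 u A asi_u.1 asi_u.2 FA.
have iyp := sqr_int _ _ _ asi_yp.
have i1 := integrable_RVZ P (1 + s k ^+ 2) _ iyp.
have i2 := integrable_RVZ P (- (t k / 2)) _ (r_int k).
have i3 := integrable_RVZ P (2 * L ^+ 2 * s k) _ (e_int k).
have i4 := integrable_RVZ P (2 * t k) _ iu.
have i5 := integrable_RVZ P (t k ^+ 2) _ (M'_int k).
have i12 := integrable_RVD P _ _ i1 i2.
have i123 := integrable_RVD P _ _ i12 i3.
have i1234 := integrable_RVD P _ _ i123 i4.
have iy1 : integrable_RV P (fun w => eucl_norm (y k.+1 w - p w) ^+ 2).
  have [_ sp] := asi_p.
  by case: (square_integrableB P _ _ (y_square_integrable k.+1) sp).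
apply: (le_trans (int_le P A _ _ mA iy1 (integrable_RVD P _ _ i1234 i5) _)).
  move=> w; rewrite y_step mulNr.
  apply: (slow_step X f g L g_nonexpansive L_gt0 fg_lipschitz) => //.
    by rewrite s_gt0 s_le1.
  by rewrite t_gt0 t_le2.
rewrite (intD P A _ _ mA i1234 i5) (intD P A _ _ mA i123 i4) (intD P A _ _ mA i12 i3).
rewrite (intD P A _ _ mA i1 i2) !(intZ P A _ _ mA)// u0 mulr0 addr0 mulNr lerD2l.
have h1 := int_M'_le k A FA.
have Q0 : 0 <= \int[P]_(w in A) second_moment k w.
  by apply: Rintegral_ge0 => w _; exact: second_moment_ge0.
apply: (le_trans (ler_wpM2l (sqr_ge0 (t k)) h1)).
rewrite mulrCA mulrA; apply: ler_wpM2r => //; apply: ler_wpM2l (ts2 k).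
exact: ltW.
Qed.

Let int_ge0 (Y : T -> R) A : (forall w, 0 <= Y w) -> 0 <= \int[P]_(w in A) Y w.
Proof. by move=> Y0; apply: Rintegral_ge0 => w _. Qed.

Let FT k : <<s noise_events k >> setT. Proof. exact: (@measurableT _ (TF k)). Qed.

Let a_lt1 : a < 1. Proof. exact: lt_trans a_lt_b b_lt1. Qed.

Let s_tail := sqr_step_tail alpha a K1 K1_ge1 a_gt a_lt1.

(** Only [y k] can be large, since [x k] stays in a bounded set; so [Q k <= q0 + 2 * D k] closes the
    recursion. *)
Lemma second_moment_bounded : exists2 B, 0 <= B &
  forall k, \int[P]_w second_moment k w <= B.
Proof.
have [p Yp] := Yhat_nonempty; have [Bx xB] := x_bounded.
have [C C0 HC] := int_tracking_error_step.
have [tail [tail0 tailS _]] := s_tail.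
pose D k := \int[P]_w (eucl_norm (y k w - p) ^+ 2).
pose E k := \int[P]_w e k w.
pose Q k := \int[P]_w second_moment k w.
pose H k := \int[P]_w residual k w.
pose q0 := 1 + Bx ^+ 2 + 2 * eucl_norm p ^+ 2.
have q00 : 0 <= q0.
  by rewrite /q0; have := sqr_ge0 Bx; have := sqr_ge0 (eucl_norm p); lra.
have iD k : integrable_RV P (fun w => eucl_norm (y k w - p) ^+ 2).
  by apply: (sqr_int k); apply: asiB => //; exact: asi_cst.
have D0 k : 0 <= D k by apply: int_ge0 => w; rewrite sqr_ge0.
have E0 k : 0 <= E k by apply: int_ge0 => w; rewrite /e sqr_ge0.
have Qle k : Q k <= q0 + 2 * D k.
  have -> : q0 + 2 * D k = \int[P]_w (q0 + 2 * eucl_norm (y k w - p) ^+ 2).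
    rewrite (intD P _ _ _ measurableT (integrable_RV_cst P q0) (integrable_RVZ P 2 _ (iD k))).
    rewrite (intZ P _ _ _ measurableT (iD k)) int_cst_prob//.
    by rewrite probability_setT mulr1.
  apply: (int_le P _ _ _ measurableT (q_int k)).
    by apply: integrable_RVD; [exact: integrable_RV_cst|exact: integrable_RVZ].
  move=> w; rewrite /second_moment /q0.
  have h1 : eucl_norm (x k w) ^+ 2 <= Bx ^+ 2.
    by rewrite ler_pXn2r// ?nnegrE// (le_trans _ (xB k w)).
  have := sqr_eucl_normD_le2 (y k w - p) p; rewrite subrK.
  by move: h1; move: (eucl_norm _) (eucl_norm _) (eucl_norm _) (eucl_norm _) => *; lra.
(* [lambda * ((1 - mu) * s k) = 2 * L ^+ 2 * s k]: the contraction of [lambda * E] exactly cancels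
   the tracking error entering [D]. *)
pose lambda := 2 * L ^+ 2 / (1 - mu).
have lambda0 : 0 <= lambda by rewrite divr_ge0 ?(ltW mu_lt1)// mulr_ge0// sqr_ge0.
pose c' := c2 + lambda * C.
have c'0 : 0 <= c' by apply: addr_ge0; [exact: ltW|exact: mulr_ge0].
pose K := 1 + c' * (q0 + 2).
have K0 : 0 <= K by apply: addr_ge0 => //; apply: mulr_ge0 => //; exact: addr_ge0.
have [|||||B HB] := @bounded_growth R K (fun k => s k ^+ 2) tail (fun k => D k + lambda * E k).
- exact: K0.
- exact: tail0.
- exact: tailS.
- by move=> k; rewrite addr_ge0// mulr_ge0.
- move=> k.
  have h1 : E k.+1 <= (1 - (1 - mu) * s k) * E k + C * s k ^+ 2 * Q k.
    exact: HC k setT (FT k).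
  have h2 : D k.+1 <= (1 + s k ^+ 2) * D k - t k / 2 * H k
      + 2 * L ^+ 2 * s k * E k + c2 * s k ^+ 2 * Q k.
    exact: int_slow_error_step k setT (fun=> p) (FT k) (asi_cst k _ p) (fun=> Yp).
  have h3 : 0 <= t k / 2 * H k.
    apply: mulr_ge0; first by rewrite divr_ge0// ltW.
    by apply: int_ge0 => w; rewrite sqr_ge0.
  have h4 : lambda * E k.+1 <= lambda * E k - 2 * L ^+ 2 * s k * E k
      + lambda * C * s k ^+ 2 * Q k.
    apply: (le_trans (ler_wpM2l lambda0 h1)).
    have h5 : lambda * ((1 - mu) * s k) = 2 * L ^+ 2 * s k.
      by rewrite /lambda mulrA mulfVK// gt_eqF.
    rewrite -h5 (_ : lambda * (_ + _) = lambda * E k - lambda * ((1 - mu) * s k) * E k +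
      lambda * C * s k ^+ 2 * Q k)//.
    by move: (E k) (Q k) (s k) => *; ring.
  have h6 : c' * s k ^+ 2 * Q k <= c' * s k ^+ 2 * (q0 + 2 * D k).
    by apply: ler_wpM2l (Qle k); exact: mulr_ge0 c'0 (sqr_ge0 _).
  have h7 : 0 <= s k ^+ 2 * (lambda * E k).
    by apply: mulr_ge0 (sqr_ge0 _) _; exact: mulr_ge0.
  have h8 : 0 <= c' * (s k ^+ 2 * (q0 * D k)).
    by apply: mulr_ge0 c'0 _; apply: mulr_ge0 (sqr_ge0 _) _; exact: mulr_ge0.
  have h9 : 0 <= c' * (s k ^+ 2 * ((q0 + 2) * (lambda * E k))).
    apply: mulr_ge0 c'0 _; apply: mulr_ge0 (sqr_ge0 _) _; apply: mulr_ge0; first exact: addr_ge0.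
    exact: mulr_ge0.
  have h10 : 0 <= c' * (s k ^+ 2) by exact: mulr_ge0 c'0 (sqr_ge0 _).
  have h11 := sqr_ge0 (s k).
  move: h2 h3 h4 h6 h7 h8 h9 h10 h11; clear h1 Qle E0 D0 iD HC; rewrite /K /c'.
  move: (E k) (E k.+1) (D k) (D k.+1) (Q k) (H k) => E1 E2 D1 D2 Q1 H1.
  clear K K0 c' c'0 E D Q H; clearbody lambda q0.
  move: (t k / 2 * H1) (2 * L ^+ 2 * s k * E1) (s k ^+ 2) => *.
  lra.
exists (Num.max 0 (q0 + 2 * B)) => [|k]; first by rewrite le_max lexx.
apply: (@le_trans _ _ (q0 + 2 * B)); last by rewrite le_max lexx orbT.
apply: (le_trans (Qle k)); rewrite lerD2l ler_wpM2l//.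
by apply: le_trans (HB k); rewrite lerDl mulr_ge0.
Qed.

(** * Mean-square rates *)

Let K1_ge_s : (2 * a / ((1 - mu) * alpha)) `^ (1 - a)^-1 <= K1.
Proof. by apply: le_trans K1_ge; rewrite /gamma2 le_max lexx. Qed.

Let K1_ge_t : (2 * b / (1 * beta)) `^ (1 - b)^-1 <= K1.
Proof. by rewrite mul1r; apply: le_trans K1_ge; rewrite /gamma2 le_max lexx orbT. Qed.

Let half_le1 (r q : R) : 0 <= r <= 1 -> 0 < q <= 2^-1 -> r * q <= 1.
Proof.
move=> /andP[r0 r1] /andP[q0 q2]; rewrite mulr_ile1// ?(ltW q0)//.
by rewrite (le_trans q2)// invf_le1// ler1n.
Qed.

Lemma tracking_error_rate : exists2 C, 0 <= C &
  forall k, \int[P]_w e k w <= C * s k.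
Proof.
have [C C0 HC] := int_tracking_error_step.
have [B B0 HB] := second_moment_bounded.
apply: (@step_recursion _ _ _ _ alpha_gt0 a_gt0 K1_ge1 (C * B) (1 - mu)) => //.
- exact: mulr_ge0.
- by apply: half_le1 => //; case/andP: mu_bounds => m0 m1; rewrite (ltW mu_lt1) lerBlDr lerDl.
- move=> k; apply: le_trans (HC k setT (FT k)) _; rewrite lerD2l.
  rewrite (_ : C * B * s k ^+ 2 = C * s k ^+ 2 * B); last by ring.
  by apply: ler_wpM2l (HB k); exact: mulr_ge0 C0 (sqr_ge0 _).
Qed.

(* Subtracting this exponentially weighted average from y k leaves a
   Krasnoselskii-Mann iteration without noise (but with an inexact map). *)
Fixpoint averaged_noise k w : 'rV[R]_d2 :=
  if k is k'.+1 then (1 - t k') *: averaged_noise k' w + t k' *: M' k'.+1 w else 0.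
Local Notation U := averaged_noise.

Let asiS k n (V : T -> 'rV[R]_n) : asi k _ V -> asi k.+1 _ V.
Proof. by move=> [aV sV]; split => //; exact: random_vectorS. Qed.

Let asi_U k : asi k _ (U k).
Proof.
elim: k => [|k IH]; first exact: asi_cst.
apply: asiD; apply: asiZ; first exact: asiS.
by split; [exact: M'_adapted|exact: M'_square_integrable k (asi_y k).2].
Qed.

Let U_int k : integrable_RV P (fun w => eucl_norm (U k w) ^+ 2).
Proof. exact: sqr_int (asi_U k). Qed.

(** The cross term integrates to 0 and [(1 - t)^2 <= 1 - t], so [step_recursion] applies with
    [rho = 1]. *)
Lemma averaged_noise_rate : exists2 C, 0 <= C &
  forall k, \int[P]_w (eucl_norm (U k w) ^+ 2) <= C * t k.
Proof.
have [B B0 HB] := second_moment_bounded.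
apply: (@step_recursion _ _ _ _ beta_gt0 b_gt0 K1_ge1 (c2 * B) 1) => //.
- by apply: mulr_ge0 => //; exact: ltW.
- by apply: half_le1 => //; rewrite ler01 lexx.
- move=> k; rewrite mul1r.
  have [iu u0] := int_dot_M' k (asi_y k).2 (U k) setT (asi_U k).1 (asi_U k).2 (FT k).
  have i1 := integrable_RVZ P ((1 - t k) ^+ 2) _ (U_int k).
  have i2 := integrable_RVZ P (2 * (1 - t k) * t k) _ iu.
  have i3 := integrable_RVZ P (t k ^+ 2) _ (M'_int k).
  have i12 := integrable_RVD P _ _ i1 i2.
  have -> : \int[P]_w (eucl_norm (U k.+1 w) ^+ 2) = \int[P]_w ((1 - t k) ^+ 2 * eucl_norm (U k w) ^+ 2
      + 2 * (1 - t k) * t k * dot (U k w) (M' k.+1 w) + t k ^+ 2 * eucl_norm (M' k.+1 w) ^+ 2).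
    apply: eq_Rintegral => w _ /=.
    by rewrite sqr_eucl_normD !sqr_eucl_normZ dotZl dotZr; ring.
  rewrite (intD P _ _ _ measurableT i12 i3) (intD P _ _ _ measurableT i1 i2).
  rewrite !(intZ P _ _ _ measurableT)// u0 mulr0 addr0 lerD//.
    rewrite ler_wpM2r//; first by apply: int_ge0 => w; rewrite sqr_ge0.
    have t1 : t k <= 1 by rewrite (le_trans (t_le2 k))// invf_le1// ler1n.
    by rewrite expr2 ler_piMl ?subr_ge0// lerBlDr lerDl ltW.
  rewrite mulrC ler_wpM2r ?sqr_ge0//.
  apply: (le_trans (int_M'_le k setT (FT k))).
  by rewrite ler_wpM2l// ltW.
Qed.

Let z k w := y k w - U k w.

Let asi_z k : asi k _ (z k). Proof. exact: asiB. Qed.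

Let asi_zr k : asi k _ (fun w => h (z k w) - z k w).
Proof. by apply: asiB => //; exact: asi_h. Qed.

Let zr_int k : integrable_RV P (fun w => eucl_norm (h (z k w) - z k w) ^+ 2).
Proof. exact: sqr_int (asi_zr k). Qed.

Let Zr k := \int[P]_w (eucl_norm (h (z k w) - z k w) ^+ 2).
Let Hr k := \int[P]_w residual k w.
Let Er k := \int[P]_w e k w.
Let Ur k := \int[P]_w (eucl_norm (U k w) ^+ 2).

(** The noise drops out: [z k.+1 = z k + t k *: (g (x k) (y k) - z k)]. The error
    [g (x k) (y k) - h (z k)] splits at [h (y k)] into a part controlled by the tracking error and a
    part of norm at most [|U k|]. *)
Let denoised_residual_step k : Zr k.+1 <= Zr k + 2 * t k * (2 * L ^+ 2 * Er k + 2 * Ur k).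
Proof.
have i1 := integrable_RVZ P (2 * L ^+ 2) _ (e_int k).
have i2 := integrable_RVZ P 2 _ (U_int k).
have i12 := integrable_RVD P _ _ i1 i2.
have i3 := integrable_RVZ P (2 * t k) _ i12.
apply: (@le_trans _ _ (\int[P]_w (eucl_norm (h (z k w) - z k w) ^+ 2 + 2 * t k *
    (2 * L ^+ 2 * e k w + 2 * eucl_norm (U k w) ^+ 2)))); last first.
  rewrite (intD P _ _ _ measurableT (zr_int k) i3) lerD2l.
  rewrite (intZ P _ _ _ measurableT i12) (intD P _ _ _ measurableT i1 i2).
  by rewrite !(intZ P _ _ _ measurableT).
apply: (int_le P _ _ _ measurableT (zr_int k.+1) (integrable_RVD P _ _ (zr_int k) i3)) => w.
have zS : z k.+1 w = z k w + t k *: (g (x k w) (y k w) - z k w).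
  by rewrite /z y_step /=; apply/rowP => j; rewrite !mxE; ring.
rewrite zS.
apply: (le_trans (residual_step h g_nonexpansive (t k) (z k w) (g (x k w) (y k w)) _)).
  by rewrite t_gt0 t_le2.
suff : eucl_norm (g (x k w) (y k w) - h (z k w)) ^+ 2 <=
    2 * L ^+ 2 * e k w + 2 * eucl_norm (U k w) ^+ 2.
  by move=> ?; rewrite lerD2l ler_wpM2l// mulr_ge0// ltW.
have -> : g (x k w) (y k w) - h (z k w) =
    (g (x k w) (y k w) - h (y k w)) + (h (y k w) - h (z k w)) by rewrite addrA subrK.
apply: (le_trans (sqr_eucl_normD_le2 _ _)); rewrite -[2 * L ^+ 2 * _]mulrA -mulrDr.
rewrite -mulrDr ler_wpM2l//; apply: lerD.
  rewrite /e -exprMn ler_pXn2r// ?nnegrE ?mulr_ge0//.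
  by have := g_lip (x k w) (xhat X f (y k w)) (y k w) (y k w); rewrite subrr eucl_norm0 addr0.
rewrite ler_pXn2r// ?nnegrE//; apply: (le_trans (g_nonexpansive _ _)).
by rewrite /z opprB addrC subrK.
Qed.

(** The residual is 2-Lipschitz; this trades the residuals at [y k] and at [z k], in both
    directions, for a multiple of [|U k|^2]. *)
Let residual_compare u v : eucl_norm (h u - u) ^+ 2 <=
  2 * eucl_norm (h v - v) ^+ 2 + 8 * eucl_norm (u - v) ^+ 2.
Proof.
have := sqr_eucl_normD_le2 (h v - v) ((h u - u) - (h v - v)); rewrite addrC subrK.
have h1 : eucl_norm (h u - u - (h v - v)) ^+ 2 <= 4 * eucl_norm (u - v) ^+ 2.
  rewrite (_ : 4 * _ = (2 * eucl_norm (u - v)) ^+ 2); last by ring.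
  by rewrite ler_pXn2r// ?nnegrE ?mulr_ge0//; exact: residual_lipschitz.
by move: h1; move: (eucl_norm _) (eucl_norm _) (eucl_norm _) (eucl_norm _) => *; lra.
Qed.

Let int_residual_compare (V W : T -> 'rV[R]_d2) k : asi k _ V -> asi k _ W ->
  \int[P]_w (eucl_norm (h (V w) - V w) ^+ 2) <=
  2 * \int[P]_w (eucl_norm (h (W w) - W w) ^+ 2) +
  8 * \int[P]_w (eucl_norm (V w - W w) ^+ 2).
Proof.
move=> aV aW.
have iV := sqr_int _ _ _ (asiB _ _ _ _ (asi_h _ _ aV) aV).
have iW := sqr_int _ _ _ (asiB _ _ _ _ (asi_h _ _ aW) aW).
have iVW := sqr_int _ _ _ (asiB _ _ _ _ aV aW).
have i1 := integrable_RVZ P 2 _ iW; have i2 := integrable_RVZ P 8 _ iVW.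
rewrite -(intZ P _ _ _ measurableT iW) -(intZ P _ _ _ measurableT iVW).
rewrite -(intD P _ _ _ measurableT i1 i2).
by apply: (int_le P _ _ _ measurableT iV (integrable_RVD P _ _ i1 i2)).
Qed.

Let Zr_le k : Zr k <= 2 * Hr k + 8 * Ur k.
Proof.
apply: (le_trans (int_residual_compare (z k) (y k) k (asi_z k) (asi_y k))).
rewrite lerD2l ler_wpM2l// le_eqVlt; apply/orP; left; apply/eqP.
by apply: eq_Rintegral => w _; rewrite /z addrC addrA addNr add0r eucl_normN.
Qed.

Let Hr_le k : Hr k <= 2 * Zr k + 8 * Ur k.
Proof.
apply: (le_trans (int_residual_compare (y k) (z k) k (asi_y k) (asi_z k))).
rewrite lerD2l ler_wpM2l// le_eqVlt; apply/orP; left; apply/eqP.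
by apply: eq_Rintegral => w _; rewrite /z opprB addrC subrK.
Qed.

(** [weighted_rate] with weight [(k + K1) * t k] bounds the residual at [z k]. Returning to [y k]
    adds a multiple of [t k], which decays at least as fast as the claimed rate. *)
Lemma residual_rate : exists2 C, 0 <= C &
  forall k, \int[P]_w residual k w <= C / k.+1%:R `^ (1 - b).
Proof.
have [CE CE0 HE] := tracking_error_rate; have [CU CU0 HU] := averaged_noise_rate.
have [B B0 HB] := second_moment_bounded; have [p Yp] := Yhat_nonempty.
have [tail [tail0 tailS _]] := s_tail.
pose D k := \int[P]_w (eucl_norm (y k w - p) ^+ 2).
pose BD := 2 * B + 2 * eucl_norm p ^+ 2.
have asi_yp k : asi k _ (fun w => y k w - p) by apply: asiB => //; exact: asi_cst.
have BD0 : 0 <= BD by rewrite addr_ge0// mulr_ge0// sqr_ge0.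
have D_le k : D k <= BD.
  have i1 := integrable_RVZ P 2 _ (q_int k).
  have i2 := integrable_RV_cst P (2 * eucl_norm p ^+ 2).
  apply: (le_trans (int_le P _ _ _ measurableT (sqr_int _ _ _ (asi_yp k))
    (integrable_RVD P _ _ i1 i2) _)).
    move=> w; have := sqr_eucl_normD_le2 (y k w) (- p); rewrite eucl_normN.
    have := sqr_ge0 (eucl_norm (x k w)); rewrite /second_moment.
    by move: (eucl_norm _) (eucl_norm _) (eucl_norm _) (eucl_norm _) => *; lra.
  rewrite (intD P _ _ _ measurableT i1 i2) (intZ P _ _ _ measurableT (q_int k)).
  by rewrite int_cst_prob// probability_setT mulr1 lerD2r ler_wpM2l.
pose Cd := BD + 2 * L ^+ 2 * CE + c2 * B.
have LL0 : 0 <= 2 * L ^+ 2 by rewrite mulr_ge0// sqr_ge0.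
have DS k : D k.+1 + t k / 2 * Hr k <= D k + Cd * s k ^+ 2.
  have h1 : D k.+1 <= (1 + s k ^+ 2) * D k - t k / 2 * Hr k
      + 2 * L ^+ 2 * s k * Er k + c2 * s k ^+ 2 * \int[P]_w second_moment k w.
    exact: int_slow_error_step k setT (fun=> p) (FT k) (asi_cst k _ p) (fun=> Yp).
  have h2 := ler_wpM2l (sqr_ge0 (s k)) (D_le k).
  have h3 := ler_wpM2l (mulr_ge0 LL0 (ltW (s_gt0 k))) (HE k).
  have h4 := ler_wpM2l (mulr_ge0 (ltW c2_gt0) (sqr_ge0 (s k))) (HB k).
  move: h1 h2 h3 h4; rewrite -/(Er k) /Cd; clear D_le HE HU HB.
  move: (\int[P]_w second_moment k w) (Er k) (Hr k) (D k) (D k.+1) (s k) (t k).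
  by clear D; clearbody BD; move=> *; lra.
pose w k := shifted_index K1 k * t k.
have n1 k : 1 <= shifted_index K1 k by exact: shift_ge1.
have n0 k : 0 <= shifted_index K1 k by exact: le_trans (n1 k).
have U_ge0 k : 0 <= Ur k by apply: int_ge0 => v; rewrite sqr_ge0.
have E_ge0 k : 0 <= Er k by apply: int_ge0 => v; rewrite /e sqr_ge0.
have [C C0 HC] : exists2 C, 0 <= C & forall k, w k * Zr k <= C.
  apply: (@weighted_rate _ (alpha ^+ 2) (4 * L ^+ 2 * CE + 4 * CU) (8 * CU) Cd
    w s t tail Zr Hr D _ _ _ _ _ _ _ _ tail0 tailS _ _ _ DS).
  - exact: sqr_ge0.
  - apply: addr_ge0; last exact: mulr_ge0.
    by apply: mulr_ge0 => //; apply: mulr_ge0 => //; exact: sqr_ge0.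
  - exact: mulr_ge0.
  - apply: addr_ge0; last by apply: mulr_ge0 => //; exact: ltW.
    by apply: addr_ge0 => //; exact: mulr_ge0.
  - by move=> k; split => //; exact: ltW.
  - by move=> k; rewrite /w ler_peMl// ltW.
  - by move=> k; exact: shift_step_increase.
  (* With [n = k + K1]: [w t s = n t^2 s <= n s^4 <= alpha^2 s^2], by [t^2 <= s^3] and
     [n s^2 <= alpha^2]. *)
  - move=> k; have nk := n0 k; have hn := shift_sqr_step alpha a K1 K1_ge1 k (ltW a_gt).
    apply: (@le_trans _ _ (shifted_index K1 k * s k ^+ 2 * s k ^+ 2)); last first.
      by rewrite ler_wpM2r ?sqr_ge0.
    have -> : w k * t k * s k = shifted_index K1 k * (t k ^+ 2 * s k).
      by rewrite /w; move: (shifted_index K1 k) (t k) (s k) => *; ring.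
    rewrite -mulrA ler_wpM2l//.
    apply: (le_trans (ler_wpM2r (ltW (s_gt0 k)) (ts k))).
    by rewrite -exprSr -exprD.
  - by move=> k; split; apply: int_ge0 => v; rewrite sqr_ge0.
  - move=> k; apply: (le_trans (Zr_le k)); rewrite lerD2l -mulrA ler_wpM2l//; exact: HU.
  - move=> k; apply: (le_trans (denoised_residual_step k)); rewrite lerD2l.
    have h1 := ler_wpM2l LL0 (HE k).
    have h2 : Ur k <= CU * s k by apply: le_trans (HU k) _; rewrite ler_wpM2l.
    have h3 : 2 * L ^+ 2 * Er k + 2 * Ur k <= (2 * L ^+ 2 * CE + 2 * CU) * s k.
      rewrite [leRHS]mulrDl; apply: lerD; first by rewrite -[leRHS]mulrA; exact: h1.
      by rewrite -[leRHS]mulrA; exact: ler_wpM2l.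
    have t20 : 0 <= 2 * t k by rewrite mulr_ge0// ltW.
    have := ler_wpM2l t20 h3; clear; move/le_trans; apply.
    rewrite le_eqVlt; apply/orP; left; apply/eqP.
    by move: (t k) (s k) => *; ring.
have CUb0 : 0 <= 8 * CU * beta by rewrite !mulr_ge0// ltW.
have Cb0 : 0 <= 2 * (C / beta) by rewrite mulr_ge0// divr_ge0// ltW.
exists (2 * (C / beta) + 8 * CU * beta) => [|k]; first exact: addr_ge0.
pose v := k.+1%:R `^ (1 - b).
have v0 : 0 < v by rewrite powR_gt0.
rewrite -/(Hr k) -/v; apply: (le_trans (Hr_le k)); rewrite [leRHS]mulrDl; apply: lerD.
  rewrite -[leRHS]mulrA ler_wpM2l// ler_pdivlMr// ler_pdivlMr//.
  have := shift_step_lower beta b K1 beta_gt0 K1_ge1 k (ltW b_lt1).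
  move=> hs; apply: le_trans (HC k); rewrite -mulrA mulrC ler_wpM2r//.
    by apply: int_ge0 => ?; rewrite sqr_ge0.
  by rewrite mulrC.
rewrite -[leRHS]mulrA -[leRHS]mulrA ler_wpM2l//; apply: (le_trans (HU k)); rewrite ler_wpM2l//.
apply: (le_trans (step_le_powR _ _ _ beta_gt0 b_gt0 K1_ge1 k)).
(* Here [1 - b <= b], because [b > a > 1/2]. *)
rewrite ler_wpM2l ?(ltW beta_gt0)// lef_pV2 ?posrE ?powR_gt0//.
apply: ler_powR; first by rewrite ler1n.
by rewrite lerBlDr; have := a_gt; have := a_lt_b; lra.
Qed.

(** * Almost sure convergence of both iterates *)

Let step_cvg0 : s k @[k --> \oo] --> (0 : R).
Proof.
apply: (@squeeze_cvgr _ _ _ _ (fun=> 0) (fun k => alpha * (k.+1%:R `^ a)^-1)); last 2 first.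
- exact: cvg_cst.
- by rewrite -[X in _ --> X](mulr0 alpha); apply: cvgMr; exact: cvg_powR_inv.
near=> k; rewrite (ltW (s_gt0 k))/=.
exact: step_le_powR alpha_gt0 a_gt0 K1_ge1 k.
Unshelve. all: end_near. Qed.

(** Markov's inequality supplies the convergence in probability that [almost_supermartingale_cvg0]
    asks for. *)
Let cvg0_prob (Y : nat -> T -> R) (r : nat -> R) :
  (forall k, integrable_RV P (Y k)) -> (forall k w, 0 <= Y k w) ->
  (forall k, \int[P]_w Y k w <= r k) -> r k @[k --> \oo] --> (0 : R) ->
  forall eta eps : R, 0 < eta -> 0 < eps ->
    \forall n \near \oo, fine (P [set w | eta <= Y n w]) <= eps.
Proof.
move=> iY Y0 Yr r0 eta eps eta0 eps0.
have : \forall n \near \oo, r n < eta * eps.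
  move/cvgrPdist_lt : r0 => /(_ _ (mulr_gt0 eta0 eps0)); apply: filterS => n.
  by rewrite sub0r normrN; apply: le_lt_trans; exact: ler_norm.
apply: filterS => n rn; rewrite -(ler_pM2l eta0).
apply: le_trans (ltW rn); apply: le_trans (Yr n).
have mB : measurable [set w | eta <= Y n w].
  have := integrable_RV_measurable P _ (iY n) measurableT `[eta, +oo[%classic (measurable_itv _).
  by rewrite setTI; congr measurable; apply/seteqP; split => w /=; rewrite in_itv/= andbT.
apply: (le_trans (markov_set P _ (Y n) eta (ltW eta0) mB (iY n) _)) => //.
exact: int_le_setT.
Qed.

(** Dropping the contraction leaves an increment of at most [C * B * s k ^+ 2] on every event, which
    [C * B * tail] compensates. *)
Lemma tracking_error_cvg0 : {ae P, forall w,
  eucl_norm (x k w - xhat X f (y k w)) @[k --> \oo] --> (0 : R)}.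
Proof.
have [C C0 HC] := int_tracking_error_step; have [B B0 HB] := second_moment_bounded.
have [CE CE0 HE] := tracking_error_rate.
have [tail [tail0 tailS tail_cvg]] := s_tail.
have CB0 : 0 <= C * B by exact: mulr_ge0.
have e_ge0 k w : 0 <= e k w by exact: sqr_ge0.
have : {ae P, forall w, e k w @[k --> \oo] --> (0 : R)}.
  apply: (almost_supermartingale_cvg0 P noise_events noise_filtration_measurable
    noise_filtration_increasing e (fun k => C * B * tail k)) => //.
  - by move=> k; exact: mulr_ge0.
  - by rewrite -[X in _ --> X](mulr0 (C * B)); apply: cvgMr.
  - by move=> k; exact: sqr_adapted (asi_e k).
  - move=> k A FA; have mA := noise_filtration_measurable _ _ FA.
    pose I0 := \int[P]_(w in A) e k w; pose I1 := \int[P]_(w in A) e k.+1 w.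
    pose J := \int[P]_(w in A) second_moment k w.
    have h1 : I1 <= (1 - (1 - mu) * s k) * I0 + C * s k ^+ 2 * J by exact: HC.
    have h2 : J <= B.
      apply: le_trans (HB k); apply: int_le_setT => // w; exact: second_moment_ge0.
    have h3 := ler_wpM2l (mulr_ge0 C0 (sqr_ge0 (s k))) h2.
    have h4 : 0 <= (1 - mu) * s k * I0.
      apply: mulr_ge0; last exact: int_ge0.
      by apply: mulr_ge0; exact: ltW.
    have h5 := ler_wpM2l CB0 (tailS k).
    suff : I1 + C * B * tail k.+1 <= I0 + C * B * tail k by [].
    move: h1 h3 h4 h5; clear h2; clearbody I0 I1 J.
    by move: (s k) (tail k) (tail k.+1) => *; lra.
  - move=> eta eps; apply: (cvg0_prob e (fun k => CE * s k)) => //.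
    by rewrite -[X in _ --> X](mulr0 CE); apply: cvgMr.
apply: filterS => w ew.
rewrite (_ : (fun k => _) = Num.sqrt \o (fun k => e k w)); last first.
  by apply/funext => k; rewrite /= /e sqrtr_sqr ger0_norm.
by rewrite -[X in _ --> X]sqrtr0; apply: continuous_cvg => //; exact: sqrt_continuous.
Qed.

Let Y := Yhat X f g.
Let Y_closed : closed Y. Proof. exact: closed_fixpoints g_nonexpansive. Qed.
Let Y_convex : @convex_set R 'rV[R]_d2 Y. Proof. exact: convex_fixpoints g_nonexpansive. Qed.

Let residual_cvg0_prob (eta eps : R) : 0 < eta -> 0 < eps ->
  \forall n \near \oo, fine (P [set w | eta <= residual n w]) <= eps.
Proof.
have [CR CR0 HR] := residual_rate.
apply: (cvg0_prob residual (fun k => CR / k.+1%:R `^ (1 - b))) => //.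
  by move=> k w; exact: sqr_ge0.
rewrite -[X in _ --> X](mulr0 CR); apply: cvgMr; apply: cvg_powR_inv.
by rewrite subr_gt0.
Qed.

Let distance_cvg0_prob (eta eps : R) : 0 < eta -> 0 < eps ->
  \forall n \near \oo, fine (P [set w | eta <= eucl_dist (y n w) Y ^+ 2]) <= eps.
Proof.
move=> eta0 eps0; have [B B0 HB] := second_moment_bounded.
have eps20 : 0 < eps / 2 by rewrite divr_gt0.
(* Markov's inequality then gives the event [r2 <= second_moment n] probability at most [eps / 2].
   Off it [|y n|] is below [Num.sqrt r2], and [residual_gap] turns a large distance into a residual
   of at least [delta ^+ 2]. *)
pose r2 := (B + 1) / (eps / 2).
have r20 : 0 < r2 by rewrite divr_gt0// ltr_wpDl.
have seta0 : 0 < Num.sqrt eta by rewrite sqrtr_gt0.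
have [delta delta0 gap] := residual_gap h g_nonexpansive (Num.sqrt r2) (Num.sqrt eta)
  Yhat_nonempty seta0.
have d20 : 0 < delta ^+ 2 by rewrite exprn_gt0.
have := residual_cvg0_prob (delta ^+ 2) (eps / 2) d20 eps20.
apply: filterS => n Hn.
have msup (V : T -> R) (c : R) : measurable_fun [set: T] V -> measurable [set w | c <= V w].
  move=> mV; have := mV measurableT `[c, +oo[%classic (measurable_itv _).
  by rewrite setTI; congr measurable; apply/seteqP; split => w /=; rewrite in_itv/= andbT.
have m1 := msup _ r2 (integrable_RV_measurable P _ (q_int n)).
have m2 := msup _ (delta ^+ 2) (integrable_RV_measurable P _ (r_int n)).
have m3 : measurable [set w | eta <= eucl_dist (y n w) Y ^+ 2].
  apply: msup; apply: measurable_funX.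
  apply: (continuous_random_vector (y n) (fun v => eucl_dist v Y)) => //.
  exact: eucl_lipschitz_continuous (eucl_dist_lipschitz Yhat_nonempty Y_closed).
have h1 : fine (P [set w | r2 <= second_moment n w]) <= eps / 2.
  rewrite -(ler_pM2l r20).
  apply: (le_trans (markov_set P _ (second_moment n) r2 (ltW r20) m1 (q_int n) _)) => //.
  apply: (le_trans (int_le_setT P _ _ m1 (q_int n) (second_moment_ge0 n))).
  apply: (le_trans (HB n)); rewrite /r2 divfK ?gt_eqF//.
  by rewrite lerDl.
apply: (@le_trans _ _ (fine (P [set w | r2 <= second_moment n w]) +
    fine (P [set w | delta ^+ 2 <= residual n w]))); last first.
  by rewrite [leRHS]splitr; exact: lerD.
rewrite -lee_fin EFinD !prob_fineK//.
apply: (@le_trans _ _ (P ([set w | r2 <= second_moment n w] `|`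
    [set w | delta ^+ 2 <= residual n w]))); last exact: measureU2.
apply: le_measure; rewrite ?inE//; first exact: measurableU.
move=> w /= etaw; have [yr|yr] := leP (eucl_norm (y n w)) (Num.sqrt r2).
- right; rewrite /residual ler_pXn2r ?nnegrE ?(ltW delta0)//; apply: gap => //.
  have dist0 : 0 <= eucl_dist (y n w) Y by rewrite eucl_dist_proj.
  by rewrite -[leRHS](ger0_norm dist0) -sqrtr_sqr ler_wsqrtr.
- left; rewrite /second_moment -[leLHS](sqr_sqrtr (ltW r20)).
  have : Num.sqrt r2 ^+ 2 <= eucl_norm (y n w) ^+ 2.
    by rewrite ler_pXn2r ?nnegrE ?sqrtr_ge0//; exact: ltW.
  have := sqr_ge0 (eucl_norm (x n w)).
  move: (eucl_norm _ ^+ 2) (eucl_norm _ ^+ 2) (Num.sqrt r2 ^+ 2) => *; lra.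
Qed.

(** The comparison point moves with [k]: [p k] is the projection of [y k] onto [Yhat], known at time
    [k], and the distance of [y k.+1] to [Yhat] is at most its distance to [p k]. *)
Lemma slow_iterate_cvg : {ae P, forall w,
  eucl_dist (y k w) (Yhat X f g) @[k --> \oo] --> (0 : R)}.
Proof.
have [B B0 HB] := second_moment_bounded; have [CE CE0 HE] := tracking_error_rate.
have [tail [tail0 tailS tail_cvg]] := s_tail.
have [q Yq] := Yhat_nonempty.
have dist0 v : 0 <= eucl_dist v Y by rewrite eucl_dist_proj.
pose p k w := eucl_proj Y (y k w).
have Yp k w : Y (p k w) by case: (eucl_projP Yhat_nonempty Y_closed (y k w)).
have asi_p k : asi k _ (p k).
  apply: asi_lip ler01 _ (asi_y k) => u v; rewrite mul1r.
  exact: eucl_proj_nonexpansive.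
have asi_yp k : asi k _ (fun w => y k w - p k w) by exact: asiB.
have distE k w : eucl_dist (y k w) Y = eucl_norm (y k w - p k w).
  by rewrite eucl_dist_proj.
have dist_le k w : eucl_dist (y k.+1 w) Y <= eucl_norm (y k.+1 w - p k w).
  have [_ pmin] := eucl_projP Yhat_nonempty Y_closed (y k.+1 w).
  by rewrite distE; apply: pmin; exact: Yp.
pose W k w := eucl_dist (y k w) Y ^+ 2.
have WE k : W k = (fun w => eucl_norm (y k w - p k w) ^+ 2).
  by apply/funext => w; rewrite /W distE.
have W_int k : integrable_RV P (W k) by rewrite WE; exact: sqr_int (asi_yp k).
pose BD := 2 * B + 2 * eucl_norm q ^+ 2.
have BD0 : 0 <= BD by rewrite addr_ge0// mulr_ge0// sqr_ge0.
have W_le k : \int[P]_w W k w <= BD.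
  have i1 := integrable_RVZ P 2 _ (q_int k).
  have i2 := integrable_RV_cst P (2 * eucl_norm q ^+ 2).
  apply: (le_trans (int_le P _ _ _ measurableT (W_int k) (integrable_RVD P _ _ i1 i2) _)).
    move=> w; have [_ pmin] := eucl_projP Yhat_nonempty Y_closed (y k w).
    apply: (@le_trans _ _ (eucl_norm (y k w - q) ^+ 2)).
      by rewrite /W distE ler_pXn2r ?nnegrE//; exact: pmin.
    have := sqr_eucl_normD_le2 (y k w) (- q); rewrite eucl_normN.
    have := sqr_ge0 (eucl_norm (x k w)); rewrite /second_moment.
    by move: (eucl_norm _) (eucl_norm _) (eucl_norm _) (eucl_norm _) => *; lra.
  rewrite (intD P _ _ _ measurableT i1 i2) (intZ P _ _ _ measurableT (q_int k)).
  by rewrite int_cst_prob// probability_setT mulr1 lerD2r ler_wpM2l.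
have LL0 : 0 <= 2 * L ^+ 2 by rewrite mulr_ge0// sqr_ge0.
pose K := BD + 2 * L ^+ 2 * CE + c2 * B.
have K0 : 0 <= K.
  apply: addr_ge0; last by apply: mulr_ge0 => //; exact: ltW.
  by apply: addr_ge0 => //; exact: mulr_ge0.
have : {ae P, forall w, W k w @[k --> \oo] --> (0 : R)}.
  apply: (almost_supermartingale_cvg0 P noise_events noise_filtration_measurable
    noise_filtration_increasing W (fun k => K * tail k)).
  - by move=> k; exact: mulr_ge0.
  - by rewrite -[X in _ --> X](mulr0 K); apply: cvgMr.
  - by move=> k w; exact: sqr_ge0.
  - by move=> k; rewrite WE; exact: sqr_adapted (asi_yp k).
  - exact: W_int.
  - move=> k A FA; have mA := noise_filtration_measurable _ _ FA.
    pose I0 := \int[P]_(w in A) W k w; pose I1 := \int[P]_(w in A) W k.+1 w.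
    pose J := \int[P]_(w in A) second_moment k w.
    pose E0 := \int[P]_(w in A) e k w; pose H0 := \int[P]_(w in A) residual k w.
    have h1 : I1 <= (1 + s k ^+ 2) * I0 - t k / 2 * H0 + 2 * L ^+ 2 * s k * E0
        + c2 * s k ^+ 2 * J.
      rewrite /I0 WE; apply: le_trans (int_slow_error_step k A (p k) FA (asi_p k) (Yp k)).
      have [_ iyp] := square_integrableB P _ _ (y_square_integrable k.+1) (asi_p k).2.
      apply: (int_le P _ _ _ mA (W_int k.+1) iyp) => w.
      by rewrite ler_pXn2r ?nnegrE.
    have h2 : J <= B.
      apply: le_trans (HB k); apply: int_le_setT => // w; exact: second_moment_ge0.
    (* The tracking error enters multiplied by [s k]; the mean-square rate makes that term of order
       [s k ^+ 2] on every event, hence summable. *)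
    have h3 : E0 <= CE * s k.
      by apply: le_trans (HE k); apply: int_le_setT => // w; exact: sqr_ge0.
    have h4 : I0 <= BD.
      by apply: le_trans (W_le k); apply: int_le_setT => // w; exact: sqr_ge0.
    have h5 : 0 <= t k / 2 * H0.
      apply: mulr_ge0; first by rewrite divr_ge0// ltW.
      by apply: int_ge0 => w; exact: sqr_ge0.
    have g2 := ler_wpM2l (mulr_ge0 (ltW c2_gt0) (sqr_ge0 (s k))) h2.
    have g3 := ler_wpM2l (mulr_ge0 LL0 (ltW (s_gt0 k))) h3.
    have g4 := ler_wpM2l (sqr_ge0 (s k)) h4.
    have g5 := ler_wpM2l K0 (tailS k).
    suff : I1 + K * tail k.+1 <= I0 + K * tail k by [].
    move: h1 h5 g2 g3 g4 g5; clear h2 h3 h4 W_le; rewrite /K.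
    clear K K0; clearbody I0 I1 J E0 H0 BD.
    by move: (s k) (t k) (tail k) (tail k.+1) => *; lra.
  - exact: distance_cvg0_prob.
apply: filterS => w Ww.
rewrite (_ : (fun k => _) = Num.sqrt \o (fun k => W k w)); last first.
  by apply/funext => k; rewrite /= /W sqrtr_sqr ger0_norm.
by rewrite -[X in _ --> X]sqrtr0; apply: continuous_cvg => //; exact: sqrt_continuous.
Qed.

(** * The rates as expectations, and the conclusion *)

Lemma tracking_error_expectation_rate : exists2 C, 0 < C & forall k,
  ('E_P[fun w => (eucl_norm (x k w - xhat X f (y k w)) ^+ 2)%R]
     <= (C / k.+1%:R `^ a)%:E)%E.
Proof.
have [C C0 HC] := tracking_error_rate.
(* The [+ 1] only makes the constant strictly positive. *)
exists (C * alpha + 1) => [|k]; first by rewrite ltr_wpDl// mulr_ge0// ltW.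
rewrite expectation_int; last exact: e_int.
rewrite lee_fin; apply: (le_trans (HC k)).
apply: (le_trans (ler_wpM2l C0 (step_le_powR _ _ _ alpha_gt0 a_gt0 K1_ge1 k))).
by rewrite mulrA ler_wpM2r ?invr_ge0 ?powR_ge0// lerDl.
Qed.

Lemma residual_expectation_rate : exists2 C, 0 < C & forall k,
  ('E_P[fun w => (eucl_norm (g (xhat X f (y k w)) (y k w) - y k w) ^+ 2)%R]
     <= (C / k.+1%:R `^ (1 - b))%:E)%E.
Proof.
have [C C0 HC] := residual_rate.
exists (C + 1) => [|k]; first by rewrite ltr_wpDl.
rewrite expectation_int; last exact: r_int.
rewrite lee_fin; apply: (le_trans (HC k)).
by rewrite ler_wpM2r ?invr_ge0 ?powR_ge0// lerDl.
Qed.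

End two_time_scale_iteration.

Theorem theorem2p8 (R : realType) (d1 d2 : nat)
  (X : set 'rV[R]_d1)
  (f : 'rV[R]_d1 -> 'rV[R]_d2 -> 'rV[R]_d1)
  (g : 'rV[R]_d1 -> 'rV[R]_d2 -> 'rV[R]_d2)
  (mu L c1 c2 alpha beta a b K1 : R)
  (disp : measure_display) (T : measurableType disp) (P : probability T R)
  (x0 : 'rV[R]_d1) (y0 : 'rV[R]_d2)
  (M : nat -> T -> 'rV[R]_d1) (M' : nat -> T -> 'rV[R]_d2)
  (x : nat -> T -> 'rV[R]_d1) (y : nat -> T -> 'rV[R]_d2)
  (X_nonempty : X !=set0)
  (X_closed : closed X)
  (X_convex : @convex_set R 'rV[R]_d1 X)
  (X_bounded : exists B : R, forall u, X u -> eucl_norm u <= B)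
  (* (i) *)
  (mu_bounds : 0 <= mu < 1)
  (f_contraction : forall x1 x2 y',
     eucl_norm (f x1 y' - f x2 y') <= mu * eucl_norm (x1 - x2))
  (* (ii) *)
  (g_nonexpansive : forall y1 y2,
     eucl_norm (g (xhat X f y1) y1 - g (xhat X f y2) y2)
       <= eucl_norm (y1 - y2))
  (Yhat_nonempty : Yhat X f g !=set0)
  (* (iii) *)
  (L_gt0 : 0 < L) (c1_gt0 : 0 < c1)
  (fg_lipschitz : forall x1 x2 y1 y2,
     eucl_norm (f x1 y1 - f x2 y2) + eucl_norm (g x1 y1 - g x2 y2)
       <= L * (eucl_norm (x1 - x2) + eucl_norm (y1 - y2)))
  (fg_growth : forall x' y',
     eucl_norm (f x' y') + eucl_norm (g x' y')
       <= c1 * (1 + eucl_norm x' + eucl_norm y'))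
  (* (iv) *)
  (M_random : forall k, random_vector (M k.+1))
  (M'_random : forall k, random_vector (M' k.+1))
  (M_mean0 : forall k (j : 'I_d1),
     is_cond_expectation P (noise_filtration x0 y0 M M' k)
       (fun w => (M k.+1 w ord0 j)%:E) (fun=> 0%E))
  (M'_mean0 : forall k (j : 'I_d2),
     is_cond_expectation P (noise_filtration x0 y0 M M' k)
       (fun w => (M' k.+1 w ord0 j)%:E) (fun=> 0%E))
  (c2_gt0 : 0 < c2)
  (noise_variance : forall k, exists Z : T -> \bar R,
     is_cond_expectation P (noise_filtration x0 y0 M M' k)
       (fun w => (eucl_norm (M k.+1 w) ^+ 2 + eucl_norm (M' k.+1 w) ^+ 2)%:E) Z
     /\ {ae P, forall w,
          (Z w <= (c2 * (1 + eucl_norm (x k w) ^+ 2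
                           + eucl_norm (y k w) ^+ 2))%:E)%E})
  (* (v) *)
  (a_gt : 2^-1 < a) (a_lt_b : a < b) (b_lt1 : b < 1)
  (alpha_bounds : 0 < alpha <= 2^-1) (beta_bounds : 0 < beta <= 2^-1)
  (K1_ge1 : 1 <= K1)
  (step_ratio : forall k,
     step_size beta b K1 k ^+ 2 / step_size alpha a K1 k ^+ 3 <= 1)
  (* the iteration *)
  (x_init : forall w, x 0%N w = x0)
  (y_init : forall w, y 0%N w = y0)
  (x_step : forall k w,
     x k.+1 w = eucl_proj X (x k w + step_size alpha a K1 k *:
                          (f (x k w) (y k w) - x k w + M k.+1 w)))
  (y_step : forall k w,
     y k.+1 w = y k w + step_size beta b K1 k *:
                  (g (x k w) (y k w) - y k w + M' k.+1 w))
  (beta_alpha : beta / alpha <= gamma1 mu L)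
  (K1_ge : gamma2 mu alpha beta a b <= K1) :
  (exists C1 C2 : R, [/\ 0 < C1, 0 < C2 &
     forall k : nat,
       ('E_P[fun w => (eucl_norm (x k w - xhat X f (y k w)) ^+ 2)%R]
          <= (C1 / k.+1%:R `^ a)%:E)%E /\
       ('E_P[fun w =>
               (eucl_norm (g (xhat X f (y k w)) (y k w) - y k w) ^+ 2)%R]
          <= (C2 / k.+1%:R `^ (1 - b))%:E)%E]) /\
  {ae P, forall w,
     (eucl_norm (x k w - xhat X f (y k w)) @[k --> \oo] --> (0 : R)) /\
     (eucl_dist (y k w) (Yhat X f g) @[k --> \oo] --> (0 : R))}.
Proof.
have [C1 C10 HC1] : exists2 C, 0 < C & forall k,
    ('E_P[fun w => (eucl_norm (x k w - xhat X f (y k w)) ^+ 2)%R]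
       <= (C / k.+1%:R `^ a)%:E)%E.
  by apply: (tracking_error_expectation_rate X f g mu L c1 c2 alpha beta a b K1 P
    x0 y0 M M' x y).
have [C2 C20 HC2] : exists2 C, 0 < C & forall k,
    ('E_P[fun w => (eucl_norm (g (xhat X f (y k w)) (y k w) - y k w) ^+ 2)%R]
       <= (C / k.+1%:R `^ (1 - b))%:E)%E.
  by apply: (residual_expectation_rate X f g mu L c1 c2 alpha beta a b K1 P
    x0 y0 M M' x y).
split; first by exists C1, C2; split.
have cvgx : {ae P, forall w,
    eucl_norm (x k w - xhat X f (y k w)) @[k --> \oo] --> (0 : R)}.
  by apply: (tracking_error_cvg0 X f g mu L c1 c2 alpha beta a b K1 P
    x0 y0 M M' x y).
have cvgy : {ae P, forall w,
    eucl_dist (y k w) (Yhat X f g) @[k --> \oo] --> (0 : R)}.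
  by apply: (slow_iterate_cvg X f g mu L c1 c2 alpha beta a b K1 P x0 y0 M M' x y).
by apply: filterS2 cvgx cvgy.
Qed.
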